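(* Let $c_0,\delta_0>0$ and let $a\in[0,1]^{\mathbb{Z}}$ be an irreducible, aperiodic sequence. Let $\alpha\in(1/2,2/3)$. There are $c,C\in(0,+\infty)$ and $n_0\geq 1$ such that for any $n\geq n_0$ and any independent sequence $X_1,\dots,X_n$ of random variables with laws in $\mathcal{M}_{\delta_0,c_0}^a$ the following holds. For any $0\leq u,v\leq n^{\alpha}$, $$P_u\bigl(\bar S_n=v,\ \min_{i=1,\dots,n}\bar S_i\geq 0\bigr)\leq\frac{C\min(u+1,\sqrt n)\min(v+1,\sqrt n)}{n^{3/2}}e^{-c(u-v)^2/n}.$$
   Context: Here $u,v$ are real. Write $\bar X_i=X_i-E(X_i)$. Under $P_u$, $\bar S_0=u$ and $\bar S_k=u+\bar X_1+\dots+\bar X_k$. $\mathcal{M}_{\mathbb{Z}}$ is the set of probability measures on $\mathbb{Z}$; $p(i)$ is the mass of $p$ at $i$. A measure $p\in\mathcal{M}_{\mathbb{Z}}$ is called irreducible (resp. aperiodic) if the random walk on $\mathbb{Z}$ with i.i.d. steps of law $p$ is an irreducible (resp. aperiodic) Markov chain. A sequence $a=(a_i)_{i\in\mathbb{Z}}\in[0,1]^{\mathbb{Z}}$ is irreducible and aperiodic if there are an irreducible and aperiodic $p\in\mathcal{M}_{\mathbb{Z}}$ and numbers $b_i>0$, $i\in\mathbb{Z}$, with $a_i=b_ip(i)$ for all $i$. For $\delta,c>0$, $$\mathcal{M}_{\delta,c}^a=\Bigl\{p\in\mathcal{M}_{\mathbb{Z}}:\ \sup_{|t|\leq\delta}\sum_{k\in\mathbb{Z}}p(k)e^{tk}\leq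 c,\ p(i)\geq a_i\ \forall i\in\mathbb{Z}\Bigr\}.$$ *)

(* Defs.v *)
From HB Require Import structures.
From mathcomp Require Import all_boot all_order all_algebra.
From mathcomp Require Import all_classical all_reals all_analysis.

Set Implicit Arguments.
Unset Strict Implicit.
Unset Printing Implicit Defensive.

Import Order.TTheory GRing.Theory Num.Theory.
Import numFieldNormedType.Exports.

Local Open Scope classical_set_scope.
Local Open Scope ring_scope.

(* As the library does for nat, int carries the sigma-algebra of all its
   subsets; [probability int R] is then the set of probability measures on Z. *)
HB.instance Definition _ := isPointed.Build int 0.
HB.instance Definition _ := @isMeasurable.Build default_measure_display
  int discrete_measurable discrete_measurable0
  discrete_measurableC discrete_measurableU.

Section MarkovChains.
Context {R : realType} {I : choiceType}.
Implicit Type K : I -> I -> \bar R.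

Fixpoint nstep K (n : nat) (x y : I) : \bar R :=
  if n is m.+1 then (\esum_(z in [set: I]) (K x z * nstep K m z y))%E
  else ((x == y)%:R)%:E.

Definition irreducible_chain K :=
  forall x y : I, exists n : nat, (0 < nstep K n x y)%E.

(* The gcd of the return times to x is 1, i.e., 1 is their only common divisor;
   this fails if x has no return time. *)
Definition aperiodic_chain K :=
  forall (x : I) (d : nat),
    (forall n : nat, (0 < n)%N -> (0 < nstep K n x x)%E -> (d %| n)%N) ->
    d = 1%N.

End MarkovChains.

Section Classes.
Context {R : realType}.
Implicit Types (p : probability int R) (a : int -> R).

Definition mass p (i : int) : R := fine (p [set i]).

Definition walk_kernel p (x y : int) : \bar R := (mass p (y - x))%:E.

Definition irreducible_law p := irreducible_chain (walk_kernel p).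

Definition aperiodic_law p := aperiodic_chain (walk_kernel p).

Definition irreducible_aperiodic_seq a :=
  exists (p : probability int R) (b : int -> R),
    [/\ irreducible_law p, aperiodic_law p,
        forall i, 0 < b i & forall i, a i = b i * mass p i].

Definition exp_moment p (t : R) : \bar R :=
  \esum_(k in [set: int]) (mass p k * expR (t * k%:~R))%:E.

Definition law_class (delta c : R) a (p : probability int R) : Prop :=
  (ereal_sup (exp_moment p @` [set t : R | (`|t| <= delta)%R]) <= c%:E)%E /\
  forall i, a i <= mass p i.

End Classes.

Section RandomVariables.
Context {d d' : measure_display} {T : measurableType d}
  {T' : measurableType d'} {R : realType} {P : probability T R}.

Definition mutually_independent (n : nat) (X : 'I_n -> {RV P >-> T'}) :=
  forall (J : {set 'I_n}) (B : 'I_n -> set T'),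
    (forall i, measurable (B i)) ->
    P (\bigcap_(i in [set` J]) (X i @^-1` B i)) =
    (\prod_(i in J) P (X i @^-1` B i))%E.

End RandomVariables.

Section CenteredWalk.
Context {d : measure_display} {T : measurableType d} {R : realType}
  {P : probability T R}.

Definition centered (X : {RV P >-> int}) (w : T) : R :=
  (X w)%:~R - fine 'E_P[(fun w' => (X w')%:~R : R)].

(* X is indexed from 0: (X i) is the (i+1)-st step. *)
Definition centered_walk (n : nat) (X : 'I_n -> {RV P >-> int}) (u : R)
    (k : nat) (w : T) : R :=
  u + \sum_(i < n | (i < k)%N) centered (X i) w.

(* The minimum over k = 1, ..., n; for n >= 1 the default value of the big
   operator is itself one of the terms. *)
Definition centered_walk_min (n : nat) (X : 'I_n -> {RV P >-> int}) (u : R)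
    (w : T) : R :=
  \big[Order.min/centered_walk X u n w]_(1 <= k < n.+1) centered_walk X u k w.

End CenteredWalk.

(* Main.v *)
Require Import Defs.
From HB Require Import structures.
From mathcomp Require Import all_boot all_order all_algebra.
From mathcomp Require Import all_classical all_reals all_analysis.
From mathcomp Require Import measurable_realfun.
From mathcomp Require Import ring lra zify.

Import Order.TTheory GRing.Theory Num.Theory.
Import numFieldNormedType.Exports.

Local Open Scope classical_set_scope.
Local Open Scope ring_scope.

(** The two constraints at the endpoints of the path and the local constraint on
its final value are decoupled by cutting the time interval into three thirds:
staying nonnegative during the first third costs a factor of order
[min (u+1) (sqrt n) / sqrt n], hitting a prescribed value at the end of the
middle third costs [1 / sqrt n], and staying nonnegative while being led to [v]
during the last third costs [min (v+1) (sqrt n) / sqrt n].  The Gaussian factor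
comes from an exponential change of measure.

Tilting.  Weight a path by [exp (lam * displacement)] with
[lam = (v - u) / (2 * C1 * n)], where the centered exponential moments of all the
steps lie between [1 + c1 t^2] and [1 + C1 t^2] ([laplace_ge], [laplace_le]).
Undoing the tilt gains [exp (- (v-u)^2 / (4 * C1 * n))].  The tilted steps have
a drift of order [lam], which may be much larger than [1 / sqrt n], so the cost
of staying nonnegative becomes [(|lam| + 1 / sqrt n) * (u + 1)].  Compared with
the drift-free cost this loses only a power of [1 + |v-u| / sqrt n], which half
of the Gaussian gain absorbs ([gauss_absorb]).

Ballot estimates.  With [rho] decreasing geometrically in time, the function
[1 + s B - rho e^(-s x) - s e^(-eta x) + s eps e^(-2 eta x)] is nonnegative on
the whole line and, as long as the walk is nonnegative, a supermartingale
([barrier_ge0], [barrier_step]).  It is at least [1 - rho] on the half line and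
of order [s (x + 1)] at time 0, where [s] is a large multiple of
[|lam| + 1 / sqrt n].  Integrating it against the mass function bounds the
surviving mass ([ballot_mass]); comparing it pointwise with a bounded mass
function, with time reversed, gives the bound near the endpoint without any
duality argument ([ballot_sup]).

Concentration.  An irreducible law charges two distinct points
([irreducible_two_atoms]), so every step of the class is, with probability
bounded below, a fair choice between the same two points.  The law of the sum is
then a mixture of translated binomial laws with a random number of trials of
order [n], and the central binomial coefficient gives the bound [1 / sqrt n]
([evolution_spread]). *)

(** * Sums of nonnegative families *)

Section NonnegativeSums.
Context {R : realType}.
Implicit Types (I J : choiceType).

Lemma le_esumZl {I} (x : R) (a : I -> \bar R) : 0 <= x ->
  (forall i, 0 <= a i)%E ->
  (\esum_(i in [set: I]) (x%:E * a i) <= x%:E * \esum_(i in [set: I]) a i)%E.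
Proof.
move=> x0 a0; apply: ge_ereal_sup => _ [X [finX _]] <-.
rewrite -ge0_mule_fsumr//; apply: lee_wpmul2l; first by rewrite lee_fin.
by apply: ereal_sup_ubound; exists X.
Qed.

Lemma esumZl {I} (x : R) (a : I -> \bar R) : 0 <= x ->
  (forall i, 0 <= a i)%E ->
  (\esum_(i in [set: I]) (x%:E * a i) = x%:E * \esum_(i in [set: I]) a i)%E.
Proof.
move=> x0 a0; apply/eqP; rewrite eq_le le_esumZl//=.
have [<-|xN0] := eqVneq 0 x.
  by rewrite mul0e esum_ge0// => i _; rewrite mul0e.
have {x0 xN0} x0 : 0 < x by rewrite lt_neqAle xN0.
rewrite -[leRHS]mul1e -(@divff _ x) ?gt_eqF// EFinM -muleA.
apply: lee_wpmul2l; first by rewrite lee_fin ltW.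
apply: le_trans (le_esumZl _ _ _ _); last 2 first.
- by rewrite invr_ge0 ltW.
- by move=> i; rewrite mule_ge0// lee_fin ltW.
apply: le_esum => i _; rewrite muleA -EFinM mulVf ?gt_eqF// mul1e//.
Qed.

Lemma exchange_esum {I J} (a : I -> J -> \bar R) :
  (forall i j, 0 <= a i j)%E ->
  (\esum_(i in [set: I]) \esum_(j in [set: J]) a i j =
   \esum_(j in [set: J]) \esum_(i in [set: I]) a i j)%E.
Proof.
move=> a0; rewrite !esum_esum//.
rewrite (reindex_esum ([set: J] `*`` fun=> [set: I]) _ (fun k => (k.2, k.1)))//.
split=> //=.
- by move=> [i j] [k l] _ _ [-> ->].
- by move=> [i j] _; exists (j, i).
Qed.

Lemma esum_subz (j : int) (a : int -> \bar R) :
  (\esum_(i in [set: int]) a (j - i)%R = \esum_(i in [set: int]) a i)%E.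
Proof.
rewrite [RHS](reindex_esum [set: int] _ (fun i => j - i))//; split=> //=.
- by move=> i k _ _ /addrI/oppr_inj.
- by move=> i _; exists (j - i) => //; rewrite opprB addrC subrK.
Qed.

Lemma esum_addz (j : int) (a : int -> \bar R) :
  (\esum_(i in [set: int]) a (i + j)%R = \esum_(i in [set: int]) a i)%E.
Proof.
rewrite [RHS](reindex_esum [set: int] _ (fun i => i + j))//; split=> //=.
- by move=> i k _ _ /addIr.
- by move=> i _; exists (i - j) => //; rewrite subrK.
Qed.

Lemma esum_eq1 {I} (i : I) (a : I -> R) : 0 <= a i ->
  \esum_(j in [set: I]) (((j == i)%:R * a j)%:E) = (a i)%:E.
Proof.
move=> a0; rewrite (esumID [set i]); last first.
  by move=> j _; case: eqP => [->|_]; rewrite ?mul1r ?mul0r lee_fin.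
rewrite setTI esum_set1 ?eqxx ?mul1r ?lee_fin// esum1 ?adde0//.
by move=> j [_ /= /eqP/negPf ->]; rewrite mul0r.
Qed.

End NonnegativeSums.

(** The fibers of [pickle] are empty or singletons; they turn sums and unions
indexed by a countable type into sums and unions indexed by [nat], for which
countable additivity is stated. *)
Section PickleFibers.
Context {I : countType}.

Definition pickle_fiber (c : nat) : set I := [set i | pickle i = c].

Lemma pickle_fiber_cases c :
  pickle_fiber c = set0 \/ exists i, pickle_fiber c = [set i].
Proof.
have [[i Fi]|none] := pselect (exists i, pickle_fiber c i); last first.
  by left; apply/seteqP; split=> // i Fi; case: none; exists i.
right; exists i; apply/seteqP; split=> [j /= Fj|j /= ->//].
by apply: (pcan_inj pickleK); rewrite Fj -Fi.
Qed.

Lemma trivIset_pickle_fiber : trivIset [set: nat] pickle_fiber.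
Proof.
apply/trivIsetP => i j _ _ /eqP ij; apply/seteqP; split=> // k [/= ki kj].
by apply: ij; rewrite -ki.
Qed.

Lemma bigcup_pickle_fiber : \bigcup_c pickle_fiber c = [set: I].
Proof. by apply/seteqP; split=> // i _; exists (pickle i). Qed.

End PickleFibers.
(** * The barrier function *)

(** The Laplace transform of the weights [q], recentered at [mu].  After
tilting, [q] has mass at most 1 and its barycenter is no longer [mu]. *)
Definition laplace {R : realType} (q : int -> R) (mu t : R) : \bar R :=
  \esum_(l in [set: int]) (q l * expR (t * (l%:~R - mu)))%:E.

(** At scale [1 / s], [1 - rho e^(-s x)] is the main term.  It becomes negative
below 0, where the walk may land by overshooting; [s * B] and the positive term
in [e^(-2 eta x)] restore the sign.  The latter has the wrong monotonicity under
a step, which the term [- s e^(-eta x)] compensates on the half line. *)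
Definition barrier {R : realType} (s eta B eps rho x : R) : R :=
  1 + s * B - rho * expR (- s * x)
    - s * expR (- eta * x) + s * eps * expR (- (2 * eta) * x).

Section Barrier.
Context {R : realType}.
Implicit Types (s eta B eps rho x : R).

(** Convexity of the exponential between 0 and [y], obtained from its tangent
line at [th * y]. *)
Lemma expR_interp (th y : R) : 0 <= th <= 1 ->
  expR (th * y) <= 1 + th * (expR y - 1).
Proof.
move=> /andP[th0 th1]; set e := expR (th * y).
have e0 : 0 < e := expR_gt0 _.
have h1 : e * (1 + (1 - th) * y) <= expR y.
  have -> : y = th * y + (1 - th) * y by ring.
  rewrite expRD ler_pM2l//.
  have -> : th * y + (1 - th) * y = y by ring.
  exact: expR_ge1Dx.
have h2 : e * (1 - th * y) <= 1.
  have := expR_ge1Dx (- (th * y)); rewrite expRN -/e => h.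
  by rewrite mulrC -ler_pdivlMr// mul1r.
have := lerD (ler_wpM2l th0 h1) (ler_wpM2l (_ : 0 <= 1 - th) h2).
by rewrite subr_ge0 => /(_ th1); nra.
Qed.

(** By convexity [e^(-s x)] is at most linear in [E = e^(-eta x)], so that the
barrier dominates [s] times a quadratic polynomial in [E]; the hypothesis on
[4 * B * eps] makes its discriminant nonpositive. *)
Lemma barrier_ge0 s eta B eps rho x : 0 < s <= eta -> 0 <= rho <= 1 ->
  0 <= B -> 0 < eps -> (1 / eta + 1) ^+ 2 <= 4 * B * eps ->
  0 <= barrier s eta B eps rho x.
Proof.
move=> /andP[s0 seta] /andP[rho0 rho1] B0 eps0 disc.
have eta0 : 0 < eta := lt_le_trans s0 seta.
rewrite /barrier; set E := expR (- eta * x).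
have E0 : 0 < E := expR_gt0 _.
have -> : expR (- (2 * eta) * x) = E ^+ 2.
  by rewrite expr2 -expRD; congr expR; ring.
have th01 : 0 <= s / eta <= 1.
  by rewrite (divr_ge0 (ltW s0) (ltW eta0)) ler_pdivrMr// mul1r.
have h := expR_interp _ (- eta * x) th01; rewrite -/E in h.
have Es : s / eta * (- eta * x) = - s * x by field; rewrite gt_eqF.
rewrite Es in h; move: h; set F := expR (- s * x) => h.
have F0 : 0 < F := expR_gt0 _.
set k := 1 / eta in disc *.
have sk : s / eta = s * k by rewrite /k mul1r.
rewrite sk in h th01; case/andP: th01 => _ th1.
have k0 : 0 < k by rewrite /k divr_gt0.
have h1 : rho * F <= 1 + s * k * E.
  apply: (@le_trans _ _ (1 + s * k * (E - 1) + s * k)); last by nra.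
  have : 0 <= s * k by rewrite mulr_ge0 ?ltW.
  by move=> ?; nra.
have h2 : 0 <= B - (k + 1) * E + eps * E ^+ 2.
  have : 0 <= 4 * eps * (B - (k + 1) * E + eps * E ^+ 2).
    have := sqr_ge0 (2 * eps * E - (k + 1)); nra.
  by rewrite pmulr_rge0// mulr_gt0.
have := mulr_ge0 (ltW s0) h2; lra.
Qed.

Lemma barrier_ge s eta B eps rho x : 0 < s -> 0 < eta -> 0 <= rho -> 1 <= B ->
  0 <= eps -> 0 <= x -> 1 - rho <= barrier s eta B eps rho x.
Proof.
move=> s0 eta0 rho0 B1 eps0 x0; rewrite /barrier.
have h1 : expR (- s * x) <= 1.
  by rewrite -expR0 ler_expR mulNr oppr_le0 mulr_ge0// ltW.
have h2 : expR (- eta * x) <= 1.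
  by rewrite -expR0 ler_expR mulNr oppr_le0 mulr_ge0// ltW.
have h3 : 0 <= s * eps * expR (- (2 * eta) * x).
  by rewrite !mulr_ge0 ?expR_ge0// ltW.
nra.
Qed.

Lemma barrier_le s eta B eps x : 0 < s -> 0 < eta -> 1 <= B -> 0 <= eps ->
  0 <= x -> barrier s eta B eps 1 x <= s * (B + eps) * (x + 1).
Proof.
move=> s0 eta0 B1 eps0 x0; rewrite /barrier.
have h1 := expR_ge1Dx (- s * x).
have h2 : expR (- (2 * eta) * x) <= 1.
  by rewrite -expR0 ler_expR mulNr oppr_le0 !mulr_ge0// ltW.
have h3 : 0 <= s * expR (- eta * x) by rewrite mulr_ge0 ?expR_ge0// ltW.
have h4 : s * eps * expR (- (2 * eta) * x) <= s * eps.
  by rewrite ler_piMr// mulr_ge0// ltW.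
have h5 : 0 <= s * x * (B + eps - 1).
  by rewrite !mulr_ge0//; lra.
nra.
Qed.

(** What the barrier needs from one step: the main term requires the moment of
order [s] to beat the decay rate [r] of [rho], and the correction terms require a
definite growth [1 + kap] at [eta] and a bounded moment at [2 * eta].  The sign
[sg] is 1 for the walk run forward and -1 for the walk seen from its endpoint. *)
Record good_step (q : int -> R) (mu sg s eta r kap C2 : R) : Prop := GoodStep {
  gs_ge0 : forall l, 0 <= q l;
  gs_mass : (\esum_(l in [set: int]) (q l)%:E <= 1)%E;
  gs_s : (r^-1%:E <= laplace q mu (- (sg * s)))%E;
  gs_eta : ((1 + kap)%:E <= laplace q mu (- (sg * eta)))%E;
  gs_2eta : (laplace q mu (- (sg * (2 * eta))) <= C2%:E)%E }.

(** The barrier is a supermartingale while the walk is nonnegative.  The terms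
with negative coefficients are moved to the other side, so that only sums of
nonnegative terms occur. *)
Lemma barrier_step q mu sg s eta r kap C2 B eps rho x :
  good_step q mu sg s eta r kap C2 ->
  0 < s <= eta -> 0 < r -> 0 <= rho -> rho * r <= 1 -> 0 <= B -> 0 < eps ->
  (1 / eta + 1) ^+ 2 <= 4 * B * eps -> eps * C2 <= kap -> 0 <= x ->
  (\esum_(l in [set: int])
     (q l * barrier s eta B eps (rho * r) (x + sg * (l%:~R - mu)))%:E
   <= (barrier s eta B eps rho x)%:E)%E.
Proof.
move=> [q0 qm qs qe q2e] /andP[s0 seta] r0 rho0 rhor B0 eps0 disc epsC x0.
have eta0 : 0 < eta := lt_le_trans s0 seta.
have bar0 y : 0 <= barrier s eta B eps (rho * r) y.
  by apply: barrier_ge0 => //; rewrite ?s0// mulr_ge0// ltW.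
set E := expR (- eta * x).
have E0 : 0 < E := expR_gt0 _.
have E1 : E <= 1 by rewrite -expR0 ler_expR mulNr oppr_le0 mulr_ge0// ltW.
have eE t (l : int) : expR (- t * (x + sg * (l%:~R - mu))) =
    expR (- t * x) * expR (- (sg * t) * (l%:~R - mu)).
  by rewrite -expRD; congr expR; ring.
have e2 : expR (- (2 * eta) * x) = E ^+ 2.
  by rewrite expr2 -expRD; congr expR; ring.
have scale (c t : R) : 0 <= c -> (\esum_(l in [set: int])
    (q l * (c * expR (- (sg * t) * (l%:~R - mu))))%:E =
    c%:E * laplace q mu (- (sg * t)))%E.
  move=> c0; rewrite /laplace -esumZl//; last first.
    by move=> l; rewrite lee_fin mulr_ge0 ?expR_ge0.
  by apply: eq_esum => l _; rewrite -EFinM; congr EFin; ring.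
pose neg (l : int) := rho * r * expR (- s * x) * expR (- (sg * s) * (l%:~R - mu))
  + s * E * expR (- (sg * eta) * (l%:~R - mu)).
pose pos (l : int) := 1 + s * B +
  s * eps * E ^+ 2 * expR (- (sg * (2 * eta)) * (l%:~R - mu)).
have neg0 l : 0 <= neg l.
  by rewrite /neg addr_ge0// !mulr_ge0 ?expR_ge0// ltW.
have posE (l : int) : barrier s eta B eps (rho * r) (x + sg * (l%:~R - mu)) + neg l = pos l.
  by rewrite /barrier /neg /pos !eE -/E e2; ring.
have sumE : (\esum_(l in [set: int])
     (q l * barrier s eta B eps (rho * r) (x + sg * (l%:~R - mu)))%:E
   + \esum_(l in [set: int]) (q l * neg l)%:E =
   \esum_(l in [set: int]) (q l * pos l)%:E)%E.
  rewrite -esumD => [|l _|l _]; try by rewrite lee_fin mulr_ge0.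
  by apply: eq_esum => l _; rewrite -posE -EFinD -mulrDr.
have posle : (\esum_(l in [set: int]) (q l * pos l)%:E <=
    (1 + s * B + s * eps * E ^+ 2 * C2)%:E)%E.
  rewrite (eq_esum (b := fun l => ((1 + s * B)%:E * (q l)%:E + (q l *
    (s * eps * E ^+ 2 * expR (- (sg * (2 * eta)) * (l%:~R - mu))))%:E)%E));
    last by move=> l _; rewrite -EFinM -EFinD /pos; congr EFin; ring.
  have c0 : 0 <= 1 + s * B by rewrite addr_ge0// mulr_ge0// ltW.
  have c1 : 0 <= s * eps * E ^+ 2 by rewrite !mulr_ge0 ?sqr_ge0// ltW.
  rewrite esumD; last 2 first.
  - by move=> l _; rewrite -EFinM lee_fin mulr_ge0.
  - by move=> l _; rewrite lee_fin !mulr_ge0 ?expR_ge0// ltW.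
  rewrite esumZl// scale// (EFinD (1 + s * B)).
  apply: leeD; last by rewrite [leRHS]EFinM; apply: lee_wpmul2l => //; rewrite lee_fin.
  by rewrite -[leRHS]mule1; apply: lee_wpmul2l => //; rewrite lee_fin.
have negge : ((rho * expR (- s * x) + s * E * (1 + kap))%:E <=
    \esum_(l in [set: int]) (q l * neg l)%:E)%E.
  have c0 : 0 <= rho * r * expR (- s * x).
    by rewrite !mulr_ge0 ?expR_ge0// ltW.
  have c1 : 0 <= s * E by rewrite !mulr_ge0// ltW.
  rewrite (eq_esum (b := fun l => ((q l * (rho * r * expR (- s * x) *
     expR (- (sg * s) * (l%:~R - mu))))%:E + (q l *
    (s * E * expR (- (sg * eta) * (l%:~R - mu))))%:E)%E)); last first.
    by move=> l _; rewrite -EFinD /neg; congr EFin; ring.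
  rewrite esumD; last 2 first.
  - by move=> l _; rewrite lee_fin mulr_ge0// mulr_ge0// expR_ge0.
  - by move=> l _; rewrite lee_fin mulr_ge0// mulr_ge0// expR_ge0.
  rewrite !scale// (EFinD (rho * _)); apply: leeD; last first.
    by rewrite EFinM; apply: lee_wpmul2l => //; rewrite lee_fin.
  have -> : rho * expR (- s * x) = rho * r * expR (- s * x) * r^-1.
    by field; rewrite gt_eqF.
  by rewrite EFinM; apply: lee_wpmul2l => //; rewrite lee_fin.
set A := (\esum_(l in _) _)%E in sumE *.
set N := (\esum_(l in _) _)%E in sumE negge.
have A0 : (0 <= A)%E by apply: esum_ge0 => l _; rewrite lee_fin mulr_ge0.
have : (A + (rho * expR (- s * x) + s * E * (1 + kap))%:E <=
   (1 + s * B + s * eps * E ^+ 2 * C2)%:E)%E.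
  by apply: le_trans posle; rewrite -sumE leeD2l.
case: A A0 {sumE} => [A A0| |]//; rewrite -EFinD !lee_fin => hA.
rewrite /barrier -/E e2.
suff : s * eps * E ^+ 2 * C2 <= s * E * kap + s * eps * E ^+ 2 by lra.
apply: (@le_trans _ _ (s * E * kap)); last first.
  by rewrite lerDl !mulr_ge0 ?sqr_ge0// ltW.
have -> : s * eps * E ^+ 2 * C2 = s * E * (E * (eps * C2)) by ring.
rewrite ler_wpM2l//; first by rewrite mulr_ge0// ltW.
apply: (@le_trans _ _ (E * kap)); first by rewrite ler_wpM2l// ltW.
have [k0|k0] := leP 0 kap; first by rewrite ler_piMl.
have C0 : (0 <= laplace q mu (- (sg * (2 * eta))))%E.
  by apply: esum_ge0 => l _; rewrite lee_fin mulr_ge0 ?expR_ge0.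
have := le_trans C0 q2e; rewrite lee_fin => C20.
have := mulr_ge0 (ltW eps0) C20; lra.
Qed.

End Barrier.
(** * Killed walks and ballot estimates *)

Section KilledWalk.
Context {R : realType}.

(** Sub-solutions of the forward equation: killing the walk only removes
mass. *)
Record evolution (m : nat) (f q : nat -> int -> R) : Prop := Evolution {
  ev_ge0 : forall k j, 0 <= f k j;
  ev_step : forall k j, (k < m)%N ->
    ((f k.+1 j)%:E <= \esum_(i in [set: int]) (f k i * q k (j - i))%:E)%E }.

Lemma evolution_sum m f q k (h : int -> R) : evolution m f q -> (k < m)%N ->
  (forall l, 0 <= q k l) -> (forall j, 0 <= h j) ->
  (\esum_(j in [set: int]) (f k.+1 j * h j)%:E <=
   \esum_(i in [set: int]) ((f k i)%:E *
      \esum_(l in [set: int]) (q k l * h (l + i)%R)%:E))%E.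
Proof.
move=> [f0 fS] km q0 h0.
rewrite [leRHS](eq_esum (b := fun i => (\esum_(j in [set: int])
   (f k i * (q k (j - i) * h j))%:E)%E)); last first.
  move=> i _; rewrite -esumZl//; last by move=> l; rewrite lee_fin mulr_ge0.
  rewrite -[RHS](esum_addz i); apply: eq_esum => l _.
  by rewrite -EFinM /= addrK.
rewrite -exchange_esum; last by move=> j i; rewrite lee_fin !mulr_ge0.
apply: le_esum => j _.
rewrite [leRHS](eq_esum (b := fun i => ((h j)%:E * (f k i * q k (j - i))%:E)%E));
  last by move=> i _; rewrite -EFinM; congr EFin; ring.
rewrite esumZl//; last by move=> i; rewrite lee_fin mulr_ge0.
by rewrite mulrC EFinM; apply: lee_wpmul2l; [rewrite lee_fin|exact: fS].
Qed.

Lemma evolution_mass m f q k : evolution m f q -> (k <= m)%N ->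
  (forall k, (k < m)%N -> forall l, 0 <= q k l) ->
  (forall k, (k < m)%N -> (\esum_(l in [set: int]) (q k l)%:E <= 1)%E) ->
  (\esum_(j in [set: int]) (f k j)%:E <= \esum_(j in [set: int]) (f 0 j)%:E)%E.
Proof.
move=> ev; elim: k => [//|k IH] km q0 q1.
apply: le_trans (IH (ltnW km) q0 q1).
under eq_esum do rewrite -[f _ _]mulr1.
apply: le_trans (evolution_sum _ _ _ _ (fun=> 1) ev km (q0 _ km) _) _ => //.
apply: le_esum => i _; rewrite -[leRHS]mule1.
apply: lee_wpmul2l; first by rewrite lee_fin; case: ev.
by under eq_esum do rewrite mulr1; exact: q1.
Qed.

Lemma evolution_sup m f q k (A : R) : evolution m f q -> (k <= m)%N ->
  0 <= A ->
  (forall k, (k < m)%N -> forall l, 0 <= q k l) ->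
  (forall k, (k < m)%N -> (\esum_(l in [set: int]) (q k l)%:E <= 1)%E) ->
  (forall j, f 0 j <= A) -> forall j, f k j <= A.
Proof.
move=> ev km A0 q0 q1 f0A; elim: k km => [//|k IH] km j.
rewrite -lee_fin; apply: le_trans (ev_step _ _ _ ev _ j km) _.
rewrite -(esum_subz j).
apply: (@le_trans _ _ (\esum_(l in [set: int]) (A%:E * (q k l)%:E))%E).
  apply: le_esum => l _; rewrite -EFinM lee_fin subKr.
  by rewrite ler_wpM2r ?q0// IH// ltnW.
rewrite esumZl//; last by move=> l; rewrite lee_fin q0.
by rewrite -[leRHS]mule1; apply: lee_wpmul2l; [rewrite lee_fin|exact: q1].
Qed.

(** The site [j] at time [k] has real position [pos k + j]; positions follow the
centered steps, so [pos] decreases by the mean of each step. *)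
Section Ballot.
Variables (m : nat) (f q : nat -> int -> R) (mu pos : nat -> R).
Variables (s eta r kap C2 B eps sg : R).
Hypothesis ev : evolution m f q.
Hypothesis posS : forall k, (k < m)%N -> pos k.+1 = pos k - mu k.
Hypothesis alive : forall k j, (k <= m)%N -> pos k + j%:~R < 0 -> f k j = 0.
Hypothesis gs : forall k, (k < m)%N ->
  good_step (q k) (mu k) sg s eta r kap C2.
Hypothesis s_eta : 0 < s <= eta.
Hypothesis r01 : 0 < r <= 1.
Hypothesis rm : r ^+ m < 1.
Hypothesis B1 : 1 <= B.
Hypothesis eps0 : 0 < eps.
Hypothesis disc : (1 / eta + 1) ^+ 2 <= 4 * B * eps.
Hypothesis epsC : eps * C2 <= kap.

Let g (k : nat) := barrier s eta B eps (r ^+ k).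

Let s0 : 0 < s. Proof. by case/andP: s_eta. Qed.
Let eta0 : 0 < eta. Proof. by case/andP: s_eta; exact: lt_le_trans. Qed.
Let B0 : 0 <= B. Proof. exact: (le_trans ler01 B1). Qed.
Let r0 : 0 < r. Proof. by case/andP: r01. Qed.
Let rX k : 0 <= r ^+ k <= 1.
Proof. by case/andP: r01 => /ltW ? ?; rewrite exprn_ge0 ?exprn_ile1. Qed.

Let g0 k x : 0 <= g k x.
Proof. exact: barrier_ge0. Qed.

Let g_step k k' x : (k < m)%N -> 0 <= x ->
  (\esum_(l in [set: int]) (q k l * g k'.+1 (x + sg * (l%:~R - mu k)))%:E
   <= (g k' x)%:E)%E.
Proof.
move=> km x0; rewrite /g exprSr; apply: (barrier_step _ _ _ _ _ _ _ _ _ _ _ _ (gs _ km)) => //.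
  by case/andP: (rX k').
by rewrite -exprSr; case/andP: (rX k'.+1).
Qed.

(** The barrier integrated against the mass function does not increase in time. *)
Lemma ballot_mass : sg = 1 -> 0 <= pos 0 ->
  (forall j, f 0 j <= (j == 0)%:R) ->
  (\esum_(j in [set: int]) (f m j)%:E <=
     (s * (B + eps) * (pos 0 + 1) / (1 - r ^+ m))%:E)%E.
Proof.
move=> sg1 u0 f0.
have f_ge0 := ev_ge0 _ _ _ ev.
(* The supermartingale property, summed over the sites. *)
have step k : (k <= m)%N -> (\esum_(j in [set: int])
    (f k j * g k (pos k + j%:~R))%:E <= (g 0 (pos 0))%:E)%E.
  elim: k => [_|k IH km].
    apply: (@le_trans _ _ (\esum_(j in [set: int])
        ((j == 0)%:R * g 0 (pos 0 + j%:~R))%:E)%E).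
      by apply: le_esum => j _; rewrite lee_fin ler_wpM2r.
    by rewrite esum_eq1 ?addr0.
  apply: le_trans (IH (ltnW km)).
  apply: le_trans (evolution_sum _ _ _ _
    (fun j => g k.+1 (pos k.+1 + j%:~R)) ev km (gs_ge0 _ _ _ _ _ _ _ _ (gs _ km)) _) _ => //.
  apply: le_esum => i _.
  have [neg|x0] := ltP (pos k + i%:~R) 0; first by rewrite (alive _ _ (ltnW km) neg) mul0r mul0e.
  rewrite [leRHS]EFinM; apply: lee_wpmul2l; first by rewrite lee_fin.
  apply: le_trans (g_step _ k _ km x0); apply: le_esum => l _.
  rewrite le_eqVlt; apply/orP; left; apply/eqP; congr (_ * g _ _)%:E.
  by rewrite posS// sg1 rmorphD/=; ring.
have r1 : 0 < 1 - r ^+ m by rewrite subr_gt0.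
rewrite EFinM muleC lee_pdivlMl//.
rewrite -(esumZl _ _ (ltW r1)); last by move=> j; rewrite lee_fin.
have stepm := step m (leqnn _).
apply: (le_trans (le_trans _ stepm)).
  apply: le_esum => j _; rewrite -EFinM lee_fin mulrC.
  have [neg|x0] := ltP (pos m + j%:~R) 0; first by rewrite alive// !mul0r.
  rewrite ler_wpM2l// barrier_ge//; first by case/andP: (rX m).
  exact: ltW.
by rewrite lee_fin /g expr0 barrier_le// ltW.
Qed.

(** A mass function bounded by [A] at time 0 is dominated at time [k] by a
multiple of the barrier of parameter [r ^+ (m - k)], because convolution with a
step is the step seen from the endpoint. *)
Lemma ballot_sup (A : R) : sg = - 1 -> 0 <= A -> (forall j, f 0 j <= A) ->
  forall j, 0 <= pos m + j%:~R ->
  f m j <= A * (s * (B + eps) * (pos m + j%:~R + 1) / (1 - r ^+ m)).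
Proof.
move=> sg1 A0 f0 j x0.
have r1 : 0 < 1 - r ^+ m by rewrite subr_gt0.
have A10 : 0 <= A / (1 - r ^+ m) by rewrite divr_ge0// ltW.
have step k i : (k <= m)%N ->
    f k i <= A / (1 - r ^+ m) * g (m - k) (pos k + i%:~R).
  elim: k i => [i _|k IH i km].
    have [neg|y0] := ltP (pos 0 + i%:~R) 0; first by rewrite alive// mulr_ge0.
    apply: le_trans (f0 i) _; rewrite mulrAC -mulrA ler_peMr// ler_pdivlMr// mul1r.
    by rewrite subn0 barrier_ge//; [case/andP: (rX m)|exact: ltW].
  have [neg|y0] := ltP (pos k.+1 + i%:~R) 0; first by rewrite alive// mulr_ge0.
  rewrite -lee_fin; apply: le_trans (ev_step _ _ _ ev _ i km) _.
  rewrite -(esum_subz i) [leRHS]EFinM.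
  apply: le_trans (lee_wpmul2l _ (g_step k _ _ km y0)); last by rewrite lee_fin.
  rewrite -esumZl//; last first.
    by move=> l; rewrite lee_fin mulr_ge0//; exact: (gs_ge0 _ _ _ _ _ _ _ _ (gs _ km)).
  apply: le_esum => l _; rewrite -EFinM lee_fin subKr.
  rewrite mulrCA mulrC ler_wpM2l//; first exact: (gs_ge0 _ _ _ _ _ _ _ _ (gs _ km)).
  apply: le_trans (IH _ (ltnW km)) _.
  rewrite subnSK// posS// sg1 rmorphB/= (_ : pos k - mu k + _ + _ = pos k + (i%:~R - l%:~R))//.
  by ring.
apply: le_trans (step m j (leqnn _)) _.
rewrite mulrAC -mulrA; apply: ler_wpM2l => //.
apply: ler_wpM2r; first by rewrite invr_ge0 ltW.
by rewrite subnn /g expr0 barrier_le// ltW.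
Qed.

End Ballot.
End KilledWalk.
(** * Concentration by splitting off coin flips *)

Section CentralBinomial.
Local Open Scope nat_scope.

Lemma leq_bin_step N i : i.*2 < N -> 'C(N, i) <= 'C(N, i.+1).
Proof.
move=> iN; rewrite -(leq_pmul2l (ltn0Sn i)) mul_bin_left.
by rewrite leq_mul2r; apply/orP; right; lia.
Qed.

(** Binomial coefficients increase up to the middle of the row. *)
Lemma leq_bin_half N i : 'C(N, i) <= 'C(N, N./2).
Proof.
have low j : j <= N./2 -> 'C(N, j) <= 'C(N, N./2).
  move=> jN; rewrite -(subKn jN); elim: (N./2 - j) => [|d IH]; first by rewrite subn0.
  have [dN|Nd] := ltnP d N./2; last by have -> : N./2 - d.+1 = N./2 - d by lia.
  apply: leq_trans IH; have -> : N./2 - d = (N./2 - d.+1).+1 by lia.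
  by apply: leq_bin_step; lia.
have [Ni|iN] := ltnP N i; first by rewrite bin_small.
have [iN2|N2i] := leqP i N./2; first exact: low.
by rewrite -bin_sub//; apply: low; lia.
Qed.

Lemma central_bin_bound n : 'C(n.*2, n) ^ 2 * n.*2.+1 <= 4 ^ n.*2.
Proof.
elim: n => [//|n IH].
have e : n.+1 * 'C(n.+1.*2, n.+1) = 2 * n.*2.+1 * 'C(n.*2, n).
  have e1 := mul_bin_diag n.+1.*2 n.
  have e2 := mul_bin_down n.*2.+1 n.
  rewrite -e1 doubleS /= in e2 *.
  have -> : n.*2.+2 = 2 * n.+1 by lia.
  rewrite -[2 * n.*2.+1 * _]mulnA e2 (_ : n.*2.+1 - n = n.+1); last by lia.
  by rewrite mulnA.
have p : 0 < n.+1 ^ 2 by rewrite expn_gt0.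
rewrite -(leq_pmul2l p) mulnA -expnMn e expnMn.
set c := 'C(n.*2, n) ^ 2 in IH *.
rewrite doubleS !(expnS 4) (_ : (2 * n.*2.+1) ^ 2 * c * n.+1.*2.+1 =
   4 * (n.*2.+1 * n.+1.*2.+1) * (c * n.*2.+1)); last first.
  by rewrite !expnS expn0; ring.
rewrite (_ : n.+1 ^ 2 * (4 * (4 * 4 ^ n.*2)) = 4 * (4 * n.+1 ^ 2) * 4 ^ n.*2);
  last by ring.
apply: leq_mul IH; rewrite leq_mul2l/=; nia.
Qed.

Lemma bin_sqr_bound N i : 'C(N, i) ^ 2 * N.+1 <= 4 ^ N.
Proof.
apply: (@leq_trans ('C(N, N./2) ^ 2 * N.+1)).
  by rewrite leq_mul2r leq_exp2r// leq_bin_half orbT.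
have [Nodd|Neven] := boolP (odd N); last first.
  have := central_bin_bound N./2.
  by have -> : N./2.*2 = N by lia.
have := central_bin_bound N./2.+1.
have NE : N./2.+1.*2 = N.+1 by lia.
rewrite NE.
have -> : 'C(N.+1, N./2.+1) = 2 * 'C(N, N./2).
  rewrite binS -(@bin_sub N N./2.+1); last by lia.
  by rewrite (_ : N - N./2.+1 = N./2); lia.
rewrite expnMn -mulnA (_ : 2 ^ 2 = 4)// (expnS 4) leq_pmul2l//.
by apply: leq_trans; rewrite leq_mul2l leqnSn orbT.
Qed.

End CentralBinomial.

Section Spread.
Context {R : realType}.
Implicit Types (f g q : int -> R).

(** One fair choice between the jumps [d1] and [d2]. *)
Definition avg (d1 d2 : int) f (j : int) : R := (f (j - d1) + f (j - d2)) / 2.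

Lemma avg_ge0 d1 d2 f : (forall j, 0 <= f j) -> forall j, 0 <= avg d1 d2 f j.
Proof. by move=> f0 j; rewrite divr_ge0// addr_ge0. Qed.

Lemma iter_avg_ge0 d1 d2 N f :
  (forall j, 0 <= f j) -> forall j, 0 <= iter N (avg d1 d2) f j.
Proof. by move=> f0; elim: N => [//|N IH] j; exact: avg_ge0. Qed.

Lemma pascal_sum N (G : nat -> R) :
  \sum_(i < N.+2) 'C(N.+1, i)%:R * G i =
  \sum_(i < N.+1) 'C(N, i)%:R * G i.+1 + \sum_(i < N.+1) 'C(N, i)%:R * G i.
Proof.
have bumpE (H : nat -> R) n : \sum_(i < n) H (lift ord0 i) = \sum_(i < n) H i.+1.
  by apply: eq_bigr => i _; rewrite lift0.
rewrite big_ord_recl (bumpE (fun i => 'C(N.+1, i)%:R * G i)).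
rewrite [X in _ = _ + X]big_ord_recl (bumpE (fun i => 'C(N, i)%:R * G i)) !bin0.
rewrite addrCA; congr (_ + _).
have -> : \sum_(i < N) 'C(N, i.+1)%:R * G i.+1 =
    \sum_(i < N.+1) 'C(N, i.+1)%:R * G i.+1.
  by rewrite [RHS]big_ord_recr/= bin_small// mul0r addr0.
rewrite -big_split/=; apply: eq_bigr => i _.
by rewrite binS natrD mulrDl addrC.
Qed.

Lemma iter_avgE d1 d2 N f j : iter N (avg d1 d2) f j =
  \sum_(i < N.+1) 'C(N, i)%:R / 2 ^+ N * f (j - d1 *+ i - d2 *+ (N - i)).
Proof.
elim: N j => [j|N IH j].
  by rewrite big_ord_recl big_ord0/= bin0 expr0 divr1 mul1r addr0 !subr0.
rewrite iterS /avg !IH.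
pose G i := (2 ^+ N)^-1 * f (j - d1 *+ i - d2 *+ (N.+1 - i)).
have -> : \sum_(i < N.+2) 'C(N.+1, i)%:R / 2 ^+ N.+1 *
      f (j - d1 *+ i - d2 *+ (N.+1 - i)) =
    2^-1 * \sum_(i < N.+2) 'C(N.+1, i)%:R * G i.
  by rewrite mulr_sumr; apply: eq_bigr => i _; rewrite exprS invfM /G; ring.
rewrite pascal_sum [LHS]mulrC; congr (_ * (_ + _)); apply: eq_bigr => i _.
  rewrite -mulrA /G subSS; congr (_ * (_ * f _)).
  by rewrite mulrS; ring.
have iN : (i <= N)%N by rewrite -ltnS.
rewrite -mulrA /G subSn//; congr (_ * (_ * f _)).
by rewrite [X in _ = _ - X]mulrS; ring.
Qed.

Lemma sum_inj_le_esum f N (e : 'I_N -> int) : (forall j, 0 <= f j) ->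
  injective e ->
  ((\sum_(i < N) f (e i))%:E <= \esum_(j in [set: int]) (f j)%:E)%E.
Proof.
move=> f0 einj; apply: esum_ge; exists [set` [seq e i | i <- enum 'I_N]].
  by split => //; exact: finite_seq.
have u : uniq [seq e i | i <- enum 'I_N] by rewrite map_inj_uniq ?enum_uniq.
by rewrite -fsbig_seq//= big_map big_enum/= sumEFin.
Qed.

(** The [N.+1] points reached by [N] jumps are distinct because [d1 != d2], so
the sum of [f] over them is at most [W]. *)
Lemma iter_avg_le d1 d2 N f (W : R) j : d1 != d2 -> (forall j, 0 <= f j) ->
  (\esum_(j in [set: int]) (f j)%:E <= W%:E)%E ->
  iter N (avg d1 d2) f j <= W * Num.sqrt (N.+1%:R^-1).
Proof.
move=> d12 f0 fW; rewrite iter_avgE.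
have W0 : 0 <= W.
  by rewrite -lee_fin; apply: le_trans fW; apply: esum_ge0 => i _; rewrite lee_fin.
apply: (@le_trans _ _ (\sum_(i < N.+1)
    Num.sqrt (N.+1%:R^-1) * f (j - d1 *+ i - d2 *+ (N - i)))).
  apply: ler_sum => i _; apply: ler_wpM2r => //.
  rewrite -[leLHS]ger0_norm ?divr_ge0//.
  rewrite -sqrtr_sqr ler_wsqrtr// expr_div_n -exprM mulnC exprM.
  rewrite ler_pdivrMr ?exprn_gt0// mulrC ler_pdivlMr//.
  have := bin_sqr_bound N i; rewrite -(ler_nat R) natrM !natrX.
  by rewrite (_ : 2 ^+ 2 = 4%:R :> R)//; rewrite -natrX.
rewrite -mulr_sumr mulrC; apply: ler_wpM2r; first exact: sqrtr_ge0.
rewrite -lee_fin; apply: le_trans fW.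
apply: (@sum_inj_le_esum f N.+1 (fun i => j - d1 *+ i - d2 *+ (N - i))) => //.
have ptE (i : 'I_N.+1) : j - d1 *+ i - d2 *+ (N - i) =
    j - d2 *+ N + (d2 - d1) *+ i.
  by rewrite mulrnBr ?mulrnBl -1?ltnS//; ring.
move=> i k /=; rewrite !ptE => /addrI/mulrIn eik; apply/val_inj/eik.
by rewrite subr_eq0 eq_sym.
Qed.

(** Averaging commutes with convolution, so fair choices can be collected at the
end regardless of the steps at which they were made. *)
Lemma avg_conv d1 d2 f g q :
  (forall j, 0 <= f j) -> (forall l, 0 <= q l) ->
  (forall j, ((g j)%:E <= \esum_(i in [set: int]) (f i * q (j - i))%:E)%E) ->
  forall j, ((avg d1 d2 g j)%:E <=
    \esum_(i in [set: int]) (avg d1 d2 f i * q (j - i))%:E)%E.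
Proof.
move=> f0 q0 gf j; have two0 : 0 <= 2^-1 :> R by rewrite invr_ge0.
have shift d : (((g (j - d)) / 2)%:E <=
    \esum_(i in [set: int]) ((f (i - d) / 2) * q (j - i))%:E)%E.
  rewrite mulrC EFinM; apply: le_trans (lee_wpmul2l _ (gf _)) _; first by rewrite lee_fin.
  rewrite -esumZl//; last by move=> i; rewrite lee_fin mulr_ge0.
  rewrite -[leRHS](esum_addz d); apply: le_esum => i _; rewrite -EFinM lee_fin addrK.
  by rewrite (_ : j - (i + d) = j - d - i) ?mulrA ?[2^-1 * _]mulrC//; ring.
rewrite /avg mulrDl EFinD; apply: le_trans (leeD (shift d1) (shift d2)) _.
rewrite -esumD; last 2 first.
- by move=> i _; rewrite lee_fin mulr_ge0// mulr_ge0.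
- by move=> i _; rewrite lee_fin mulr_ge0// mulr_ge0.
by apply: le_esum => i _; rewrite -EFinD lee_fin !mulrDl.
Qed.

Lemma iter_avg_conv d1 d2 N f g q :
  (forall j, 0 <= f j) -> (forall l, 0 <= q l) ->
  (forall j, ((g j)%:E <= \esum_(i in [set: int]) (f i * q (j - i))%:E)%E) ->
  forall j, ((iter N (avg d1 d2) g j)%:E <=
    \esum_(i in [set: int]) (iter N (avg d1 d2) f i * q (j - i))%:E)%E.
Proof.
move=> f0 q0 gf; elim: N => [//|N IH] j.
by apply: avg_conv => //; exact: iter_avg_ge0.
Qed.

(** One step is a fair choice between [d1] and [d2] with weight [2 * th], and
some residual step of mass at most [1 - 2 * th] otherwise. *)
Lemma conv_split_le d1 d2 (th M : R) f q j : d1 != d2 ->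
  (forall j, 0 <= f j <= M) -> (forall l, 0 <= q l) -> 0 <= th ->
  th <= q d1 -> th <= q d2 -> (\esum_(l in [set: int]) (q l)%:E <= 1)%E ->
  (\esum_(i in [set: int]) (f i * q (j - i))%:E <=
   (2 * th * avg d1 d2 f j + (1 - 2 * th) * M)%:E)%E.
Proof.
move=> d12 fM q0 th0 q1 q2 qm.
have f0 i : 0 <= f i by case/andP: (fM i).
have M0 : 0 <= M by case/andP: (fM 0) => ? ?; exact: le_trans (f0 0) _.
(* The residual step. *)
pose q' l := q l - th * (l == d1)%:R - th * (l == d2)%:R.
have q'0 l : 0 <= q' l.
  rewrite /q'; have [->|_] := eqVneq l d1; have [e|_] := eqVneq _ d2;
    rewrite ?mulr0 ?mulr1 ?subr0 ?subr_ge0//.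
  - by rewrite e eqxx in d12.
  - by rewrite e.
have at_ d (h : int -> R) : (forall l, 0 <= h l) ->
    (\esum_(l in [set: int]) (h l * (th * (l == d)%:R))%:E = (th * h d)%:E)%E.
  move=> h0; rewrite (eq_esum (b := fun l => ((l == d)%:R * (th * h l))%:E)).
    by rewrite esum_eq1// mulr_ge0.
  by move=> l _; congr EFin; ring.
have qE l : q l = q' l + (th * (l == d1)%:R + th * (l == d2)%:R).
  by rewrite /q'; ring.
have split3 (h : int -> R) : (forall l, 0 <= h l) ->
    (\esum_(l in [set: int]) (h l * q l)%:E =
     \esum_(l in [set: int]) (h l * q' l)%:E + (th * h d1 + th * h d2)%:E)%E.
  move=> h0; rewrite EFinD -(at_ d1 h h0) -(at_ d2 h h0).
  have e0 d l : (0 <= (h l * (th * (l == d)%:R))%:E)%E.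
    by rewrite lee_fin mulr_ge0// mulr_ge0.
  rewrite -[X in (_ + X)%E]esumD// -esumD//; last 2 first.
  - by move=> l _; rewrite lee_fin mulr_ge0.
  - by move=> l _; rewrite adde_ge0.
  by apply: eq_esum => l _; rewrite -!EFinD qE; congr EFin; ring.
have q'm : (\esum_(l in [set: int]) (q' l)%:E <= (1 - 2 * th)%:E)%E.
  have := split3 (fun=> 1) (fun=> ler01).
  under eq_esum do rewrite mul1r.
  under [X in _ = (X + _)%E]eq_esum do rewrite mul1r.
  rewrite !mulr1 => e; have -> : 2 * th = th + th by ring.
  by rewrite EFinB leeBrDr// -e.
rewrite -(esum_subz j); under eq_esum do rewrite subKr.
rewrite (split3 (fun l => f (j - l)))// addeC (EFinD (2 * th * _)); apply: leeD.
  by rewrite lee_fin /avg le_eqVlt; apply/orP; left; apply/eqP; field.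
apply: (@le_trans _ _ (\esum_(l in [set: int]) (M%:E * (q' l)%:E))%E).
  apply: le_esum => l _; rewrite -EFinM lee_fin ler_wpM2r//.
  by case/andP: (fM (j - l)).
rewrite esumZl// mulrC EFinM; apply: lee_wpmul2l => //.
Qed.

(** After squaring, by convexity, this compares an average of [1 / (x + 1)] and
[1 / x] with [1 / (x + th)]. *)
Lemma spread_rate (th x : R) : 0 <= th -> 2 * th <= 1 -> 1 <= x ->
  2 * th * Num.sqrt ((x + 1)^-1) + (1 - 2 * th) * Num.sqrt (x^-1) <=
  Num.sqrt ((x + th)^-1).
Proof.
move=> th0 th1 x1.
have x0 : 0 < x by lra.
have x10 : 0 < x + 1 by lra.
have xt0 : 0 < x + th by lra.
set a := Num.sqrt ((x + 1)^-1); set b := Num.sqrt (x^-1).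
have a2 : a ^+ 2 = (x + 1)^-1 by rewrite sqr_sqrtr// invr_ge0 ltW.
have b2 : b ^+ 2 = x^-1 by rewrite sqr_sqrtr// invr_ge0 ltW.
have a0 : 0 <= a := sqrtr_ge0 _.
have b0 : 0 <= b := sqrtr_ge0 _.
have c0 : 0 <= 2 * th * a + (1 - 2 * th) * b.
  by apply: addr_ge0; rewrite !mulr_ge0//; lra.
rewrite -[leLHS]ger0_norm// -sqrtr_sqr ler_wsqrtr//.
apply: (@le_trans _ _ (2 * th * a ^+ 2 + (1 - 2 * th) * b ^+ 2)).
  have : 0 <= 2 * th * (1 - 2 * th) * (a - b) ^+ 2.
    apply: mulr_ge0 (sqr_ge0 _).
    by rewrite !mulr_ge0//; lra.
  by lra.
rewrite a2 b2 -subr_ge0.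
have -> : (x + th)^-1 - (2 * th / (x + 1) + (1 - 2 * th) / x) =
   th * (x - 1 + 2 * th) / (x * (x + 1) * (x + th)).
  by field; rewrite !gt_eqF.
by rewrite divr_ge0 ?mulr_ge0//; lra.
Qed.

(** For the induction on time, [N] fair choices are added to the [k] steps: each
step either becomes one more fair choice or is forgotten. *)
Lemma evolution_spread m (F Q : nat -> int -> R) d1 d2 (th W : R) :
  evolution m F Q -> d1 != d2 -> 0 <= th ->
  (forall k, (k < m)%N -> forall l, 0 <= Q k l) ->
  (forall k, (k < m)%N -> (\esum_(l in [set: int]) (Q k l)%:E <= 1)%E) ->
  (forall k, (k < m)%N -> th <= Q k d1) ->
  (forall k, (k < m)%N -> th <= Q k d2) ->
  (\esum_(j in [set: int]) (F 0%N j)%:E <= W%:E)%E ->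
  forall j, F m j <= W * Num.sqrt ((1 + th * m%:R)^-1).
Proof.
move=> [F0 FS] d12 th0 Q0 Q1 Qd1 Qd2 FW.
have W0 : 0 <= W.
  by rewrite -lee_fin; apply: le_trans FW; apply: esum_ge0 => i _; rewrite lee_fin.
suff H k N j : (k <= m)%N ->
    iter N (avg d1 d2) (F k) j <= W * Num.sqrt ((N.+1%:R + th * k%:R)^-1).
  by move=> j; exact: (H m 0%N).
elim: k N j => [|k IH] N j km; first by rewrite mulr0 addr0 iter_avg_le.
have th2 : 2 * th <= 1.
  have := Q1 _ km; rewrite (esumID [set d1]); last by move=> l _; rewrite lee_fin Q0.
  rewrite setTI esum_set1 ?lee_fin ?Q0// (esumID [set d2]); last first.
    by move=> l _; rewrite lee_fin Q0.
  rewrite (_ : _ `&` [set d2] = [set d2]); last first.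
    apply/seteqP; split=> [x []//|x /= ->]; split => //; split => //=.
    by move/eqP; rewrite eq_sym (negPf d12).
  rewrite esum_set1 ?lee_fin ?Q0// addeA => h.
  have : (((Q k d1)%:E + (Q k d2)%:E) <= 1)%E.
    by apply: le_trans h; rewrite leeDl// esum_ge0// => l _; rewrite lee_fin Q0.
  by rewrite -EFinD lee_fin; have := Qd1 _ km; have := Qd2 _ km; lra.
rewrite -lee_fin; apply: le_trans (iter_avg_conv d1 d2 N _ _ _ (F0 k) (Q0 _ km) _ j) _.
  by move=> i; exact: FS.
apply: le_trans (conv_split_le d1 d2 th (W * Num.sqrt ((N.+1%:R + th * k%:R)^-1))
  _ _ _ d12 _ (Q0 _ km) th0 (Qd1 _ km) (Qd2 _ km) (Q1 _ km)) _.
  by move=> i; rewrite iter_avg_ge0//= IH// ltnW.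
rewrite lee_fin.
have hN : iter N.+1 (avg d1 d2) (F k) j <= _ := IH N.+1 j (ltnW km).
rewrite /= in hN.
apply: (@le_trans _ _ (W * (2 * th * Num.sqrt ((N.+1%:R + th * k%:R + 1)^-1) +
   (1 - 2 * th) * Num.sqrt ((N.+1%:R + th * k%:R)^-1)))).
  rewrite mulrDr; apply: lerD; last by rewrite mulrCA.
  rewrite [leRHS]mulrCA; apply: ler_wpM2l; first by rewrite mulr_ge0.
  apply: le_trans hN _; rewrite le_eqVlt; apply/orP; left; apply/eqP.
  by congr (_ * Num.sqrt (_^-1)); rewrite -[N.+2%:R]natr1; ring.
apply: ler_wpM2l => //; apply: le_trans (spread_rate _ _ th0 th2 _) _.
  by rewrite -natr1 -addrA addrCA lerDl addr_ge0// mulr_ge0.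
by rewrite -[k.+1%:R]natr1 mulrDr mulr1 addrA.
Qed.

End Spread.
(** * Exponential moments of a step *)

Section ExpInequalities.
Context {R : realType}.
Implicit Types z : R.

Lemma expR_le_quad z : expR z <= 1 + z + z ^+ 2 * expR `|z|.
Proof.
have e0 : 0 < expR z := expR_gt0 _.
have h1 : expR z * (1 - z) <= 1.
  have := expR_ge1Dx (- z); rewrite expRN => h.
  by rewrite mulrC -ler_pdivlMr// mul1r.
have h2 := expR_ge1Dx z.
case: (ger0P z) => z0; first by have := ler_wpM2l z0 h1; lra.
have := ler_wnM2l (ltW z0) h2.
suff : z ^+ 2 <= z ^+ 2 * expR (- z) by lra.
by rewrite ler_peMr ?sqr_ge0// -expR0 ler_expR oppr_ge0 ltW.
Qed.

Lemma expR_ge_quad z : - 2 <= z -> 1 + z + z ^+ 2 / 4 <= expR z.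
Proof.
move=> z2; have h := expR_ge1Dx (z / 2).
have -> : expR z = expR (z / 2) ^+ 2.
  by rewrite expr2 -expRD; congr expR; field.
have h0 : 0 <= 1 + z / 2 by lra.
by have := ler_pM h0 h0 h h; rewrite -!expr2; lra.
Qed.

Lemma sqr_le_expR z : z ^+ 2 <= 4 * expR `|z|.
Proof.
have h := expR_ge1Dx (`|z| / 2).
have -> : expR `|z| = expR (`|z| / 2) ^+ 2.
  by rewrite expr2 -expRD; congr expR; field.
have z0 := normr_ge0 z; have <- : `|z| ^+ 2 = z ^+ 2 by rewrite real_normK ?num_real.
have h0 : 0 <= `|z| / 2 by lra.
have h1 : `|z| / 2 <= expR (`|z| / 2) by lra.
by have := ler_pM h0 h0 h1 h1; rewrite -!expr2; lra.
Qed.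

End ExpInequalities.

Section Moments.
Context {d : measure_display} {T : measurableType d} {R : realType}
  {P : probability T R}.
Variable X : {RV P >-> int}.

Let p := mass (distribution P X).

Lemma mass_ge0 k : 0 <= p k.
Proof. by rewrite fine_ge0// measure_ge0. Qed.

Lemma massE k : (p k)%:E = P [set w | X w = k].
Proof. by rewrite /p /mass fineK// fin_num_measure. Qed.

Lemma measurable_int_fun d' (U : measurableType d') (h : int -> U) :
  measurable_fun [set: int] h.
Proof. by []. Qed.

Lemma measurable_funX (h : int -> R) :
  measurable_fun [set: T] (EFin \o (h \o X)).
Proof.
apply/measurable_EFinP.
exact: (measurableT_comp (measurable_int_fun _ _ h)).
Qed.

(** Expectations of functions of [X] as sums over the values of [X]. *)
Lemma integral_mass (h : int -> R) : (forall k, 0 <= h k) ->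
  (\int[P]_w (h (X w))%:E = \esum_(k in [set: int]) (p k * h k)%:E)%E.
Proof.
move=> h0.
have -> : (\int[P]_w (h (X w))%:E = \int[distribution P X]_k (h k)%:E)%E.
  by rewrite ge0_integral_distribution// => k; rewrite lee_fin.
rewrite -bigcup_pickle_fiber ge0_integral_bigcup//; last 2 first.
- by move=> k _; rewrite lee_fin.
- exact: trivIset_pickle_fiber.
rewrite esum_bigcupT; last 2 first.
- exact: trivIset_pickle_fiber.
- by move=> k; rewrite lee_fin mulr_ge0// mass_ge0.
rewrite nneseries_esumT; last by move=> n; apply: integral_ge0 => k _; rewrite lee_fin.
apply: eq_esum => n _.
case: (@pickle_fiber_cases int n) => [->|[k ->]].
  by rewrite integral_set0 esum_set0.
rewrite esum_set1 ?lee_fin ?mulr_ge0 ?mass_ge0//.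
rewrite (eq_integral (cst (h k)%:E)); last by move=> j; rewrite inE /= => ->.
rewrite integral_cst// muleC EFinM; congr (_ * _)%E.
by rewrite /p /mass fineK// fin_num_measure.
Qed.

Lemma integrable_dom (h g : int -> R) : (forall k, `|h k| <= g k) ->
  (\int[P]_w (g (X w))%:E < +oo)%E ->
  P.-integrable [set: T] (fun w => (h (X w))%:E).
Proof.
move=> hg goo.
apply: (@le_integrable _ _ _ _ _ _ _ (fun w => (g (X w))%:E)) => //.
- exact: measurable_funX.
- move=> w _ /=; rewrite lee_fin; apply: le_trans (hg _) _.
  exact: ler_norm.
- apply/integrableP; split; first exact: measurable_funX.
  rewrite (eq_integral (fun w => (g (X w))%:E))// => w _ /=.
  by rewrite ger0_norm// (le_trans _ (hg _)).
Qed.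


(** The exponential moments for [|t| <= delta] control those of [|X|], hence
every integrability question below and the size of the mean. *)
Variables (delta c : R).
Hypothesis delta0 : 0 < delta.
Hypothesis pc : forall t, `|t| <= delta ->
  (exp_moment (distribution P X) t <= c%:E)%E.

Let mu := fine 'E_P[(fun w => (X w)%:~R : R)].

Let int_exp : (\int[P]_w (expR (delta * `|(X w)%:~R|))%:E <= (2 * c)%:E)%E.
Proof.
rewrite (integral_mass (fun k => expR (delta * `|k%:~R|)))//.
have dd : `|delta| <= delta by rewrite ger0_norm// ltW.
have ddN : `|- delta| <= delta by rewrite normrN.
have -> : 2 * c = c + c by ring.
rewrite EFinD; apply: le_trans (leeD (pc _ dd) (pc _ ddN)).
rewrite /exp_moment -esumD; last 2 first.
- by move=> k _; rewrite lee_fin mulr_ge0 ?expR_ge0// mass_ge0.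
- by move=> k _; rewrite lee_fin mulr_ge0 ?expR_ge0// mass_ge0.
apply: le_esum => k _; rewrite -EFinD lee_fin -mulrDr.
apply: ler_wpM2l; first exact: mass_ge0.
have := expR_ge0 (delta * k%:~R); have := expR_ge0 (- delta * k%:~R).
by case: (ger0P (k%:~R : R)) => _; rewrite ?mulrN -?mulNr; lra.
Qed.

Let c0 : 0 <= c.
Proof.
have z : `|0 : R| <= delta by rewrite normr0 ltW.
rewrite -lee_fin; apply: le_trans (pc _ z); apply: esum_ge0 => k _.
by rewrite lee_fin mulr_ge0 ?expR_ge0// mass_ge0.
Qed.

Lemma integrableX_dom (h : int -> R) (K : R) :
  (forall k, `|h k| <= K * expR (delta * `|k%:~R|)) ->
  P.-integrable [set: T] (fun w => (h (X w))%:E).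
Proof.
move=> hK; apply: (integrable_dom _ _ hK).
have K0 : 0 <= K.
  have := le_trans (normr_ge0 _) (hK 0); rewrite normr0 mulr0 expR0 mulr1//.
rewrite (integral_mass (fun k => K * expR (delta * `|k%:~R|)))//; last first.
  by move=> k; rewrite mulr_ge0 ?expR_ge0.
rewrite (eq_esum (b := fun k => (K%:E * (p k * expR (delta * `|k%:~R|))%:E)%E));
  last by move=> k _; rewrite -EFinM; congr EFin; ring.
have e0 k : 0 <= expR (delta * `|k%:~R|) :> R by exact: expR_ge0.
rewrite esumZl//; last by move=> k; rewrite lee_fin mulr_ge0 ?mass_ge0.
rewrite -(integral_mass (fun k => expR (delta * `|k%:~R|)))//.
apply: (@le_lt_trans _ _ (K%:E * (2 * c)%:E)%E); last by rewrite -EFinM ltry.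
by apply: lee_wpmul2l => //; rewrite lee_fin.
Qed.

Let absk (k : int) : `|k%:~R : R| <= delta^-1 * expR (delta * `|k%:~R|).
Proof.
rewrite ler_pdivlMl//; have := expR_ge1Dx (delta * `|k%:~R : R|); lra.
Qed.

Let intX : P.-integrable [set: T] (fun w => ((X w)%:~R : R)%:E).
Proof. exact: (integrableX_dom (fun k => k%:~R) delta^-1 absk). Qed.

Let muE : (\int[P]_w ((X w)%:~R : R)%:E = mu%:E)%E.
Proof. by rewrite /mu unlock fineK// integrable_fin_num. Qed.

Lemma mean_bound : `|mu| <= 2 * c / delta.
Proof.
rewrite -lee_fin -[(`|mu|)%:E]/(`|mu%:E|)%E -muE.
apply: le_trans (le_abse_integral _ measurableT _) _.
  exact: (measurable_funX (fun k => k%:~R)).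
apply: (@le_trans _ _ (\int[P]_w (delta^-1 * expR (delta * `|(X w)%:~R|))%:E)%E).
  apply: ge0_le_integral => //=.
  - exact: (measurable_funX (fun k => `|k%:~R : R|)).
  - exact: (measurable_funX (fun k => delta^-1 * expR (delta * `|k%:~R|))).
  - by move=> w _; rewrite lee_fin absk.
under eq_integral do rewrite EFinM.
rewrite ge0_integralZl//; last 2 first.
- exact: (measurable_funX (fun k => expR (delta * `|k%:~R|))).
- by rewrite lee_fin invr_ge0 ltW.
by rewrite mulrC EFinM; apply: lee_wpmul2l; [rewrite lee_fin invr_ge0 ltW|].
Qed.

Let laplaceE t : (laplace p mu t = \int[P]_w (expR (t * ((X w)%:~R - mu)))%:E)%E.
Proof.
by rewrite (integral_mass (fun k => expR (t * (k%:~R - mu))))// => k; rewrite expR_ge0.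
Qed.

Let delta_mu : delta * `|mu| <= 2 * c.
Proof. by rewrite mulrC -ler_pdivlMr// mean_bound. Qed.

Let exp_centered (t : R) (k : int) : `|t| <= delta ->
  expR (`|t * (k%:~R - mu)|) <= expR (2 * c) * expR (delta * `|k%:~R|).
Proof.
move=> td; rewrite -expRD ler_expR normrM.
apply: (@le_trans _ _ (delta * (`|k%:~R| + `|mu|))).
  by apply: ler_pM => //; exact: ler_normB.
by have := delta_mu; lra.
Qed.

Let int_lin (t : R) (h : int -> R) (K : R) :
  (forall k, `|h k| <= K * expR (delta * `|k%:~R|)) ->
  P.-integrable [set: T] (fun w => (1 + t * ((X w)%:~R - mu) + h (X w))%:E) /\
  (\int[P]_w (1 + t * ((X w)%:~R - mu) + h (X w))%:E =
   1 + \int[P]_w (h (X w))%:E)%E.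
Proof.
move=> hK; have ih := integrableX_dom h K hK.
have icst (r : R) : P.-integrable [set: T] (fun=> r%:E).
  exact: finite_measure_integrable_cst.
have it : P.-integrable [set: T] (fun w => t%:E * ((X w)%:~R)%:E)%E.
  exact: integrableZl.
have ct := icst (1 - t * mu).
have i1 := integrableD measurableT ct it.
have i2 := integrableD measurableT i1 ih.
have e : (fun w => (1 + t * ((X w)%:~R - mu) + h (X w))%:E) =
  (fun w => ((1 - t * mu)%:E + t%:E * ((X w)%:~R)%:E) + (h (X w))%:E)%E.
  by apply/funext => w; rewrite -EFinM -!EFinD; congr EFin; ring.
rewrite e; split=> //.
rewrite (integralD measurableT i1 ih) (integralD measurableT ct it).
rewrite integralZl// muE -EFinM.
have -> : (\int[P]_w (1 - t * mu)%:E = (1 - t * mu)%:E)%E.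
  by rewrite -[RHS](@expectation_cst _ _ _ P) unlock.
rewrite -EFinD.
by congr (_ + _)%E; congr EFin; ring.
Qed.

(** The linear term vanishes by centering; the quadratic remainder of the
exponential is absorbed in an exponential moment at [delta], which is why [t] is
restricted to half of the range. *)
Lemma laplace_le t : `|t| <= delta / 2 ->
  (laplace p mu t <= (1 + (16 / delta ^+ 2 * expR (2 * c) * (2 * c)) * t ^+ 2)%:E)%E.
Proof.
move=> td; rewrite laplaceE.
pose K := 16 / delta ^+ 2 * expR (2 * c) * t ^+ 2.
have D0 : 0 <= 16 / delta ^+ 2 by rewrite divr_ge0 ?sqr_ge0.
have K0 : 0 <= K := mulr_ge0 (mulr_ge0 D0 (expR_ge0 _)) (sqr_ge0 _).
pose h (k : int) := K * expR (delta * `|k%:~R|).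
have hK k : `|h k| <= K * expR (delta * `|k%:~R|).
  by rewrite ger0_norm// mulr_ge0 ?expR_ge0.
have [ih eh] := int_lin t h K hK.
have ineq (k : int) : expR (t * (k%:~R - mu)) <= 1 + t * (k%:~R - mu) + h k.
  apply: le_trans (expR_le_quad _) _; rewrite lerD2l /h /K.
  set y := k%:~R - mu.
  have h1 : expR `|t * y| <= expR (`|delta / 2 * y|).
    rewrite ler_expR normrM [leRHS]normrM ler_wpM2r//.
    by apply: le_trans td _; exact: ler_norm.
  have h2 := sqr_le_expR (delta / 2 * y).
  have h3 : expR (`|delta / 2 * y|) ^+ 2 <= expR (2 * c) * expR (delta * `|k%:~R|).
    apply: le_trans (exp_centered delta k _); last by rewrite ger0_norm// ltW.
    rewrite expr2 -expRD ler_expR.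
    rewrite -mulr2n -normrMn le_eqVlt -/y; apply/orP; left; apply/eqP.
    by congr (`|_|); field.
  set e := expR (`|delta / 2 * y|) in h1 h2 h3 *.
  have e0 : 0 < e := expR_gt0 _.
  apply: (@le_trans _ _ (t ^+ 2 * (y ^+ 2 * e))).
    by rewrite exprMn -mulrA ler_wpM2l ?sqr_ge0// ler_wpM2l ?sqr_ge0.
  have h4 : y ^+ 2 * e <= 16 / delta ^+ 2 * e ^+ 2.
    rewrite (expr2 e) mulrA; apply: ler_wpM2r; first exact: ltW.
    by rewrite [leRHS]mulrAC ler_pdivlMr ?exprn_gt0//; lra.
  have h5 : 16 / delta ^+ 2 * e ^+ 2 <=
      16 / delta ^+ 2 * (expR (2 * c) * expR (delta * `|k%:~R|)).
    exact: ler_wpM2l.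
  have := ler_wpM2l (sqr_ge0 t) (le_trans h4 h5); lra.
apply: (@le_trans _ _ (\int[P]_w (1 + t * ((X w)%:~R - mu) + h (X w))%:E)%E).
  apply: ge0_le_integral => //=.
  - exact: (measurable_funX (fun k => expR (t * (k%:~R - mu)))).
  - exact: (measurable_funX (fun k => 1 + t * (k%:~R - mu) + h k)).
  - by move=> w _; rewrite lee_fin ineq.
rewrite eh EFinD leeD2l//.
under eq_integral do rewrite EFinM.
rewrite ge0_integralZl//; last first.
  exact: (measurable_funX (fun k => expR (delta * `|k%:~R|))).
apply: (@le_trans _ _ (K%:E * (2 * c)%:E)%E); first by rewrite lee_wpmul2l// lee_fin.
by rewrite -EFinM lee_fin le_eqVlt; apply/orP; left; apply/eqP; rewrite /K; ring.
Qed.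

(** Second order growth comes from the two atoms: wherever the mean is, their
squared distances to it add up to at least 1/2.  The bounds on [t] keep the exponents at
these atoms in the range of [expR_ge_quad]. *)
Lemma laplace_ge (th t : R) (d1 d2 : int) : d1 != d2 -> 0 <= th ->
  th <= p d1 -> th <= p d2 -> `|t| <= delta ->
  `|t| * (`|d1%:~R| + 2 * c / delta) <= 2 ->
  `|t| * (`|d2%:~R| + 2 * c / delta) <= 2 ->
  ((1 + th / 8 * t ^+ 2)%:E <= laplace p mu t)%E.
Proof.
move=> d12 th0 p1 p2 td t1 t2; rewrite laplaceE.
(* The quadratic gain is kept at the two atoms only; elsewhere the tangent line
   at 0 suffices. *)
pose h (k : int) := ((k == d1) || (k == d2))%:R * ((t * (k%:~R - mu)) ^+ 2 / 4).
have ge2 (k : int) : `|t| * (`|k%:~R| + 2 * c / delta) <= 2 ->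
    `|t * (k%:~R - mu)| <= 2.
  move=> /(le_trans _); apply; rewrite normrM ler_wpM2l//.
  by apply: le_trans (ler_normB _ _) _; rewrite lerD2l mean_bound.
have h_supp k : (k == d1) || (k == d2) -> `|t * (k%:~R - mu)| <= 2.
  by case/orP => /eqP ->; exact: ge2.
have h0 k : 0 <= h k by rewrite mulr_ge0// divr_ge0// sqr_ge0.
have hK k : `|h k| <= 1 * expR (delta * `|k%:~R|).
  rewrite ger0_norm// mul1r; apply: (@le_trans _ _ 1); last first.
    by rewrite -expR0 ler_expR mulr_ge0// ltW.
  rewrite /h; case: ((k == d1) || (k == d2)) (h_supp k) => [/(_ isT)|_]; last by rewrite mul0r.
  by rewrite mul1r ler_norml => /andP[? ?]; nra.
have [ih eh] := int_lin t h 1 hK.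
have ineq (k : int) : 1 + t * (k%:~R - mu) + h k <= expR (t * (k%:~R - mu)).
  rewrite /h; case: ((k == d1) || (k == d2)) (h_supp k) => [/(_ isT)|_]; last first.
    by rewrite mul0r addr0 expR_ge1Dx.
  by rewrite mul1r ler_norml => /andP[? _]; exact: expR_ge_quad.
have ie : P.-integrable [set: T] (fun w => (expR (t * ((X w)%:~R - mu)))%:E).
  apply: (integrableX_dom (fun k => expR (t * (k%:~R - mu))) (expR (2 * c))) => k.
  rewrite ger0_norm ?expR_ge0//; apply: le_trans (exp_centered t k td).
  by rewrite ler_expR ler_norm.
apply: le_trans (le_integral measurableT ih ie _); last first.
  by move=> w _; rewrite lee_fin ineq.
rewrite eh EFinD leeD2l// integral_mass//.
have ph0 k : (0 <= (p k * h k)%:E)%E by rewrite lee_fin mulr_ge0// mass_ge0.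
rewrite (esumID [set d1])// setTI esum_set1//.
have d2in : (~` [set d1]) d2 by move=> /= e; rewrite e eqxx in d12.
rewrite (esumID [set d2])// setTI (_ : _ `&` [set d2] = [set d2]); last first.
  by apply/seteqP; split=> [x []//|x /= ->].
rewrite esum_set1// addeA.
apply: (@le_trans _ _ ((p d1 * h d1)%:E + (p d2 * h d2)%:E)%E); last first.
  by rewrite leeDl// esum_ge0.
rewrite -EFinD lee_fin /h !eqxx orbT/= !mul1r.
set x1 := d1%:~R - mu; set x2 := d2%:~R - mu.
have dist : 1 <= (x1 - x2) ^+ 2.
  have -> : x1 - x2 = (d1 - d2)%:~R by rewrite /x1 /x2 rmorphB/=; ring.
  rewrite -rmorphXn/= ler1z -gtz0_ge1 lt_neqAle sqr_ge0 andbT eq_sym.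
  by rewrite sqrf_eq0 subr_eq0.
have sq : 1 / 2 <= x1 ^+ 2 + x2 ^+ 2 by have := sqr_ge0 (x1 + x2); nra.
have := ler_wpM2r (_ : 0 <= (t * x1) ^+ 2 / 4) p1.
have := ler_wpM2r (_ : 0 <= (t * x2) ^+ 2 / 4) p2.
rewrite !divr_ge0 ?sqr_ge0// => /(_ isT) h2 /(_ isT) h1.
apply: le_trans (lerD h1 h2).
have tt : 0 <= th * t ^+ 2 / 4 by rewrite divr_ge0// mulr_ge0// sqr_ge0.
have := ler_wpM2l tt sq; rewrite !exprMn; lra.
Qed.

End Moments.
(** * Atoms of irreducible laws *)

Section Atoms.
Context {R : realType}.

Lemma nstep_ge0 (K : int -> int -> \bar R) n x y :
  (forall x y, 0 <= K x y)%E -> (0 <= nstep K n x y)%E.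
Proof.
move=> K0; elim: n x => [|n IH] x /=; first by rewrite lee_fin.
by apply: esum_ge0 => z _; rewrite mule_ge0.
Qed.

(** A walk with a single possible jump moves along one arithmetic
progression. *)
Lemma nstep_point (p : probability int R) (d : int) n (x y : int) :
  (forall l, mass p l != 0 -> l = d) ->
  (0 < nstep (walk_kernel p) n x y)%E -> y = x + d *+ n.
Proof.
move=> pd; elim: n x y => [|n IH] x y /=.
  by case: eqP => [->|]; rewrite ?addr0// lte_fin ltxx.
have [//|xy] := eqVneq y (x + d *+ n.+1).
rewrite esum1 ?ltxx// => z _; rewrite /walk_kernel.
have [->|/pd zd] := eqVneq (mass p (z - x)) 0; first by rewrite mul0e.
suff /eqP -> : nstep (walk_kernel p) n z y == 0%E by rewrite mule0.
apply: contraNT xy => n0; apply/eqP; rewrite (IH z y) ?mulrS ?addrA//.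
  by rewrite -zd [x + (z - x)]addrC subrK.
rewrite lt_neqAle eq_sym n0/= nstep_ge0// => a b.
by rewrite /walk_kernel lee_fin fine_ge0// measure_ge0.
Qed.

(** With at most one atom [d], the walk started at 0 cannot reach both 1 and
-1, as the multiples of [d] by natural numbers have constant sign. *)
Lemma irreducible_two_atoms (p : probability int R) : irreducible_law p ->
  exists d1 d2 : int, [/\ d1 != d2, 0 < mass p d1 & 0 < mass p d2].
Proof.
move=> irr; apply: contrapT => noatoms.
have p0 l : 0 <= mass p l by rewrite fine_ge0// measure_ge0.
have uniq_atom l1 l2 : mass p l1 != 0 -> mass p l2 != 0 -> l1 = l2.
  move=> h1 h2; apply/eqP; apply/negP => /negP l12; apply: noatoms.
  by exists l1, l2; split=> //; rewrite lt_neqAle eq_sym ?h1 ?h2/=.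
have [d pd] : exists d, forall l, mass p l != 0 -> l = d.
  have [[d dn0]|none] := pselect (exists d, mass p d != 0).
    by exists d => l ln0; exact: uniq_atom.
  by exists 0 => l ln0; case: none; exists l.
have [n /(nstep_point _ _ _ _ _ pd) e1] := irr 0 1.
have [k /(nstep_point _ _ _ _ _ pd) e2] := irr 0 (- 1).
rewrite add0r in e1; rewrite add0r in e2.
have [d0|d0] := leP 0 d.
  by have := mulrn_wge0 k d0; rewrite -e2.
by have := mulrn_wle0 n (ltW d0); rewrite -e1.
Qed.

End Atoms.
(** * Independence of the past and the next step *)

Lemma le_measure_esum {d : measure_display} {T : measurableType d} {R : realType}
    (mu : {measure set T -> \bar R}) (I : countType) (A : set T) (F : I -> set T) :
  measurable A -> (forall i, measurable (F i)) -> A `<=` \bigcup_i F i ->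
  (mu A <= \esum_(i in [set: I]) mu (F i))%E.
Proof.
move=> mA mF AF.
pose G c := \bigcup_(i in pickle_fiber c) F i.
have GP c : measurable (G c) /\ (mu (G c) = \esum_(i in pickle_fiber c) mu (F i))%E.
  case: (@pickle_fiber_cases I c) => [J0|[i J1]].
    by rewrite /G J0 bigcup_set0 esum_set0 measure0.
  by rewrite /G J1 bigcup_set1 esum_set1.
apply: (@le_trans _ _ (\sum_(c <oo) mu (G c))%E).
  apply: measure_sigma_subadditive => //.
  - by move=> c; case: (GP c).
  - by move=> w /AF [i _ Fi]; exists (pickle i) => //; exists i.
rewrite nneseries_esumT// -bigcup_pickle_fiber esum_bigcupT//; last first.
  exact: trivIset_pickle_fiber.
by apply: le_esum => c _; case: (GP c) => _ ->.
Qed.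

(** The product rule for finite families only speaks of cylinders.  An event
depending on the first [k] variables is a countable disjoint union of cells on
which these variables are constant; a natural number codes the cell. *)
Section Prefix.
Context {d : measure_display} {T : measurableType d} {R : realType}
  {P : probability T R} {n : nat}.
Variable X : 'I_n -> {RV P >-> int}.

Lemma measurable_atom i (l : int) : measurable [set w | X i w = l].
Proof.
by rewrite -[X in measurable X]setTI; exact: (@measurable_funPT _ _ _ _ (X i) _ [set l]).
Qed.

Hypothesis indep : mutually_independent X.

Let code (k : nat) (w : T) : nat :=
  pickle [seq X i w | i <- [seq i : 'I_n <- enum 'I_n | (i < k)%N]].

Let codeP k w w' : code k w = code k w' <->
  forall i : 'I_n, (i < k)%N -> X i w = X i w'.
Proof.
split=> [/(pcan_inj pickleK) e i ik|e].
  have /eq_in_map : [seq X i w | i <- [seq i : 'I_n <- enum 'I_n | (i < k)%N]] =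
    [seq X i w' | i <- [seq i : 'I_n <- enum 'I_n | (i < k)%N]] := e.
  by apply; rewrite mem_filter ik mem_enum.
congr pickle; apply/eq_in_map => i; rewrite mem_filter => /andP[ik _].
exact: e.
Qed.

Let cell k w0 := [set w | forall i : 'I_n, (i < k)%N -> X i w = X i w0].

Let cellE k w0 : cell k w0 =
  \bigcap_(i in [set` [set i : 'I_n | (i < k)%N]%SET]) (X i @^-1` [set X i w0]).
Proof.
apply/seteqP; split=> w /=.
  by move=> h i /=; rewrite inE => ik; exact: h.
by move=> h i ik; apply: h => /=; rewrite inE.
Qed.

Let measurable_cell k w0 : measurable (cell k w0).
Proof.
rewrite cellE; apply: fin_bigcap_measurable => // i _; exact: measurable_atom.
Qed.

Let cell_indep (k : 'I_n) w0 (l : int) :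
  P (cell k w0 `&` [set w | X k w = l]) = (P (cell k w0) * P [set w | X k w = l])%E.
Proof.
pose J := [set i : 'I_n | (i < k)%N]%SET.
pose B (i : 'I_n) : set int := if (i < k)%N then [set X i w0] else [set l].
have mB i : measurable (B i) by [].
have kJ : k \notin J by rewrite inE ltnn.
have Bk : B k = [set l] by rewrite /B ltnn.
have cE : cell k w0 = \bigcap_(i in [set` J]) (X i @^-1` B i).
  rewrite cellE; apply: eq_bigcapr => i /=; rewrite inE /B => -> //.
have := indep (k |: J)%SET B mB; rewrite big_setU1//= -(indep J B mB) -cE Bk.
rewrite muleC => <-; congr (P _); apply/seteqP; split=> w /=.
  rewrite cE => -[h Xk] i /=; rewrite !inE => /orP[/eqP ->|ik]; first by rewrite Bk.
  by apply: h => /=; rewrite inE.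
move=> h; split.
  by rewrite cE => i /= iJ; apply: h; rewrite /= inE iJ orbT.
by have := h k; rewrite /= !inE eqxx Bk; apply.
Qed.

Section PrefixEvent.
Variables (k : nat) (E : set T).
Hypothesis Ek : forall w w',
  (forall i : 'I_n, (i < k)%N -> X i w = X i w') -> E w -> E w'.

Let C c := [set w | E w /\ code k w = c].

Let Ccell c w0 : C c w0 -> C c = cell k w0.
Proof.
move=> [E0 c0]; apply/seteqP; split=> w /=.
  by move=> [_ cw]; apply/codeP; rewrite cw c0.
move=> h; split; first by apply: Ek E0 => i ik; rewrite h.
by rewrite -c0; apply/codeP.
Qed.

Let C_cases c : C c = set0 \/ exists w0, C c = cell k w0.
Proof.
have [[w0 Cw0]|no] := pselect (exists w, C c w).
  by right; exists w0; exact: Ccell.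
by left; apply/seteqP; split=> // w Cw; case: no; exists w.
Qed.

Let mC c : measurable (C c).
Proof. by case: (C_cases c) => [->//|[w0 ->]]; exact: measurable_cell. Qed.

Let EC : E = \bigcup_c C c.
Proof.
by apply/seteqP; split=> [w Ew|w [c _ []]//]; exists (code k w).
Qed.

Lemma prefix_measurable : measurable E.
Proof. by rewrite EC; exact: bigcupT_measurable. Qed.

Lemma prefix_independent (i : 'I_n) (l : int) : i = k :> nat ->
  P (E `&` [set w | X i w = l]) = (P E * P [set w | X i w = l])%E.
Proof.
move=> ik; have tC : trivIset setT C.
  apply/trivIsetP => a b _ _ /eqP ab; apply/seteqP; split=> // w [[_ wa] [_ wb]].
  by apply: ab; rewrite -wa.
have Cind c : P (C c `&` [set w | X i w = l]) = (P (C c) * P [set w | X i w = l])%E.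
  case: (C_cases c) => [->|[w0 ->]]; first by rewrite set0I measure0 mul0e.
  by rewrite -ik; exact: cell_indep.
rewrite EC setI_bigcupl measure_bigcup//; last 2 first.
- by move=> c _; apply: measurableI => //; exact: measurable_atom.
- exact: trivIset_setIr.
rewrite measure_bigcup//.
have fk : P [set w | X i w = l] \is a fin_num.
  by rewrite fin_num_measure//; exact: measurable_atom.
rewrite muleC -(fineK fk) -nneseriesZl//; apply: eq_eseriesr => c _.
by rewrite fineK// [RHS]muleC; exact: Cind.
Qed.

End PrefixEvent.

End Prefix.
(** * Combining the three thirds *)

Section ThreeThirds.
Context {R : realType}.

Lemma evolution_shift N m k0 (f q : nat -> int -> R) : (k0 + m <= N)%N ->
  evolution N f q ->
  evolution m (fun k => f (k0 + k)%N) (fun k => q (k0 + k)%N).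
Proof.
move=> km [f0 fS]; split=> // k j kltm; rewrite addnS; apply: fS.
by apply: leq_trans km; rewrite ltn_add2l.
Qed.

(** The minima with 1 come from the trivial estimates (mass at most 1, supremum
not increased), which replace the ballot estimates when an endpoint is far from
0. *)
Lemma three_thirds_bound n m (f q : nat -> int -> R) (mu pos : nat -> R)
    (s eta r kap C2 B eps th : R) (d1 d2 : int) :
  (m.*2 + m <= n)%N ->
  evolution n f q ->
  (forall j, f 0%N j <= (j == 0)%:R) ->
  0 <= pos 0%N ->
  (forall k, (k < n)%N -> pos k.+1 = pos k - mu k) ->
  (forall k j, (k <= n)%N -> pos k + j%:~R < 0 -> f k j = 0) ->
  (forall k, (k < n)%N -> good_step (q k) (mu k) 1 s eta r kap C2) ->
  (forall k, (k < n)%N -> good_step (q k) (mu k) (- 1) s eta r kap C2) ->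
  d1 != d2 -> 0 <= th ->
  (forall k, (k < n)%N -> th <= q k d1) ->
  (forall k, (k < n)%N -> th <= q k d2) ->
  0 < s <= eta -> 0 < r <= 1 -> r ^+ m <= 1 / 2 -> 1 <= B -> 0 < eps ->
  (1 / eta + 1) ^+ 2 <= 4 * B * eps -> eps * C2 <= kap ->
  forall j, 0 <= pos n + j%:~R ->
  f n j <= Num.min 1 (2 * (s * (B + eps)) * (pos 0%N + 1))
           * Num.sqrt ((1 + th * m%:R)^-1)
           * Num.min 1 (2 * (s * (B + eps)) * (pos n + j%:~R + 1)).
Proof.
move=> mn ev f01 u0 posS alive gs1 gsN1 d12 th0 qd1 qd2 s_eta r01 rm B1 eps0
  disc epsC j v0.
have f0 := ev_ge0 _ _ _ ev.
have q0 k : (k < n)%N -> forall l, 0 <= q k l by move=> kn; case: (gs1 k kn).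
have q1 k : (k < n)%N -> (\esum_(l in [set: int]) (q k l)%:E <= 1)%E.
  by move=> kn; case: (gs1 k kn).
have s0 : 0 <= s by case/andP: s_eta => /ltW.
have L0 : 0 <= 2 * (s * (B + eps)) by rewrite !mulr_ge0//; lra.
have half (x : R) k : (m <= k)%N -> 0 <= x ->
    s * (B + eps) * x / (1 - r ^+ k) <= 2 * (s * (B + eps)) * x.
  move=> mk x0; have rk : r ^+ k <= 1 / 2.
    apply: le_trans rm; case/andP: r01 => r0 r1.
    by apply: ler_wiXn2l => //; exact: ltW.
  rewrite ler_pdivrMr; last by lra.
  have sx : 0 <= s * (B + eps) * x by rewrite !mulr_ge0//; lra.
  by nra.
have rlt k : (m <= k)%N -> r ^+ k < 1.
  move=> mk; apply: (@le_lt_trans _ _ (1 / 2)); last by lra.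
  apply: le_trans rm; case/andP: r01 => r0 r1.
  by apply: ler_wiXn2l => //; exact: ltW.
set W := Num.min 1 (2 * (s * (B + eps)) * (pos 0%N + 1)).
have mn1 : (0 + m <= n)%N by clear -mn; lia.
have mn2 : (m + m <= n)%N by clear -mn; lia.
have mn3 : (m.*2 + (n - m.*2) <= n)%N by clear -mn; lia.
have fm : (\esum_(j in [set: int]) (f m j)%:E <= W%:E)%E.
  rewrite /W EFin_min le_min; apply/andP; split.
    apply: le_trans (evolution_mass _ _ _ m (evolution_shift _ _ 0 _ _ mn1 ev) _ _ _) _ => //.
    - by move=> k km; apply: q0; clear -mn km; lia.
    - by move=> k km; apply: q1; clear -mn km; lia.
    apply: (@le_trans _ _ (\esum_(j in [set: int]) ((j == 0)%:R * 1)%:E)%E).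
      by apply: le_esum => i _; rewrite lee_fin mulr1 f01.
    by rewrite esum_eq1.
  apply: le_trans (ballot_mass m f q mu pos s eta r kap C2 B eps 1
    (evolution_shift _ _ 0 _ _ mn1 ev) _ _ _ _ _ _ _ _ _ _ _ _ _) _ => //.
  - by move=> k km; apply: posS; clear -mn km; lia.
  - by move=> k i km; apply: alive; clear -mn km; lia.
  - by move=> k km; apply: gs1; clear -mn km; lia.
  - exact: rlt.
  - by rewrite lee_fin half// addr_ge0.
have W0 : 0 <= W by rewrite /W le_min ler01 mulr_ge0// addr_ge0.
set A := W * Num.sqrt ((1 + th * m%:R)^-1).
have A0 : 0 <= A by rewrite mulr_ge0// sqrtr_ge0.
have fA i : f m.*2 i <= A.
  rewrite -addnn.
  apply: (evolution_spread m _ _ d1 d2 th W (evolution_shift _ _ m _ _ mn2 ev) d12 th0).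
  - by move=> k km; apply: q0; clear -mn km; lia.
  - by move=> k km; apply: q1; clear -mn km; lia.
  - by move=> k km; apply: qd1; clear -mn km; lia.
  - by move=> k km; apply: qd2; clear -mn km; lia.
  - by rewrite addn0.
have ev3 := evolution_shift _ _ m.*2 _ _ mn3 ev.
have nE : (m.*2 + (n - m.*2) = n)%N by clear -mn; lia.
rewrite minr_pMr// le_min mulr1; apply/andP; split.
  rewrite -nE; apply: (evolution_sup _ _ _ _ A ev3) => //.
  - by move=> k km; apply: q0; clear -mn km; lia.
  - by move=> k km; apply: q1; clear -mn km; lia.
  - by move=> i; rewrite addn0.
apply: (@le_trans _ _ (A * (s * (B + eps) * (pos n + j%:~R + 1) / (1 - r ^+ (n - m.*2))))).
  rewrite -[in f _ _]nE -[in pos _]nE.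
  apply: (ballot_sup (n - m.*2) _ _ (fun k => mu (m.*2 + k)%N)
    (fun k => pos (m.*2 + k)%N) s eta r kap C2 B eps (- 1) ev3) => //.
  - by move=> k km; rewrite addnS; apply: posS; clear -mn km; lia.
  - by move=> k i km; apply: alive; clear -mn km; lia.
  - by move=> k km; apply: gsN1; clear -mn km; lia.
  - by apply: rlt; clear -mn; lia.
  - by move=> i; rewrite addn0.
  - by rewrite nE.
by apply: ler_wpM2l => //; apply: half; [clear -mn; lia|rewrite addr_ge0].
Qed.

End ThreeThirds.

(** * Exponential tilting *)

Section Tilt.
Context {R : realType}.

Definition tilt (lam a mu : R) (p : int -> R) (l : int) : R :=
  p l * expR (lam * (l%:~R - mu)) / a.

Lemma laplace_tilt lam a mu p t : 0 < a -> (forall l, 0 <= p l) ->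
  laplace (tilt lam a mu p) mu t = (a^-1%:E * laplace p mu (lam + t))%E.
Proof.
move=> a0 p0; rewrite /laplace -esumZl.
- apply: eq_esum => l _; rewrite -EFinM mulrDl expRD /tilt; congr EFin; ring.
- by rewrite invr_ge0 ltW.
- by move=> l; rewrite lee_fin mulr_ge0// expR_ge0.
Qed.

(** Tilting shifts the argument of the Laplace transform by [lam], so the
quadratic bounds on the original law are evaluated at [lam - sg * t].  The choice
[s = |lam| + K * rho] keeps that point at distance at least [K * rho] from 0,
whatever the sign of the drift created by the tilt. *)
Lemma tilted_good_step (p : int -> R) (mu lam c1 C1 D eta K rho s sg : R) :
  (forall l, 0 <= p l) ->
  (forall t, `|t| <= D -> (laplace p mu t <= (1 + C1 * t ^+ 2)%:E)%E) ->
  (forall t, `|t| <= D -> ((1 + c1 * t ^+ 2)%:E <= laplace p mu t)%E) ->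
  0 < c1 <= C1 -> C1 * lam ^+ 2 <= c1 * eta ^+ 2 / 16 ->
  c1 * eta ^+ 2 <= 1 -> 0 < eta -> `|lam| <= eta / 2 -> 4 * eta <= D ->
  0 <= K -> 0 <= rho -> s = `|lam| + K * rho -> s <= eta -> `|sg| = 1 ->
  good_step (tilt lam (1 + C1 * lam ^+ 2) mu p) mu sg s eta
    ((1 + C1 * lam ^+ 2) / (1 + c1 * K ^+ 2 * rho ^+ 2))
    (c1 * eta ^+ 2 / 16) (1 + C1 * D ^+ 2).
Proof.
move=> p0 up low /andP[c10 c1C1] lam_small eta1 eta0 lam_eta etaD K0 rho0 sE s_eta sg1.
set a := 1 + C1 * lam ^+ 2.
have C10 : 0 < C1 := lt_le_trans c10 c1C1.
have a1 : 1 <= a by rewrite lerDl mulr_ge0// ?sqr_ge0// ltW.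
have a0 : 0 < a by lra.
have q0 l : 0 <= tilt lam a mu p l.
  by rewrite divr_ge0 ?(ltW a0)// mulr_ge0// expR_ge0.
have Dlam (t : R) : `|t| <= 2 * eta -> `|lam - t| <= D.
  move=> t2; apply: le_trans (ler_normB _ _) _; lra.
have sgt (t : R) : 0 <= t -> `|sg * t| = t.
  by move=> t0; rewrite normrM sg1 mul1r ger0_norm.
have Krho : 0 <= K * rho by rewrite mulr_ge0.
have s0 : 0 <= s by rewrite sE addr_ge0.
have sg2 : sg ^+ 2 = 1 by rewrite -real_normK ?num_real// sg1 expr1n.
have ainv : 0 <= a^-1 by rewrite invr_ge0 ltW.
have gap (t : R) : 0 <= t -> (t - `|lam|) ^+ 2 <= (lam - sg * t) ^+ 2.
  move=> t0; have : lam * sg <= `|lam|.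
    by apply: le_trans (ler_norm _) _; rewrite normrM sg1 mulr1.
  have : `|lam| ^+ 2 = lam ^+ 2 by rewrite real_normK ?num_real.
  by move=> e h; have := ler_wpM2l t0 h; nra.
have lower (t : R) (y : R) : 0 <= t <= 2 * eta -> y <= (t - `|lam|) ^+ 2 ->
   (((1 + c1 * y) / a)%:E <= laplace (tilt lam a mu p) mu (- (sg * t)))%E.
  move=> /andP[t0 t2] yt; rewrite laplace_tilt// mulrC EFinM.
  apply: lee_wpmul2l; first by rewrite lee_fin.
  apply: le_trans (low _ _); last by apply: Dlam; rewrite sgt.
  rewrite lee_fin lerD2l ler_wpM2l ?(ltW c10)//.
  exact: le_trans (gap _ t0).
split=> //.
- have := laplace_tilt lam a mu p 0 a0 p0; rewrite addr0.
  rewrite [X in X = _](_ : _ = (\esum_(l in [set: int]) (tilt lam a mu p l)%:E)%E).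
    move=> ->; rewrite -[leRHS](_ : (a^-1%:E * a%:E = 1)%E); last first.
      by rewrite -EFinM mulVf ?gt_eqF.
    apply: lee_wpmul2l; first by rewrite lee_fin.
    by apply: up; lra.
  by apply: eq_esum => l _; rewrite mul0r expR0 mulr1.
- rewrite invf_div -mulrA; apply: lower.
    by rewrite s0; lra.
  by rewrite sE addrAC subrr add0r exprMn.
- apply: le_trans (lower eta (eta ^+ 2 / 4) _ _).
  + rewrite lee_fin ler_pdivlMr// /a.
    set y := c1 * eta ^+ 2 in lam_small eta1 *.
    have y0 : 0 <= y by rewrite mulr_ge0 ?sqr_ge0// ltW.
    set z := C1 * lam ^+ 2 in lam_small *.
    have z0 : 0 <= z by rewrite mulr_ge0 ?sqr_ge0// ltW.
    have -> : c1 * (eta ^+ 2 / 4) = y / 4 by rewrite mulrA.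
    by nra.
  + by rewrite ltW//=; lra.
  + by have := normr_ge0 lam; nra.
- rewrite laplace_tilt//.
  have h : (laplace p mu (lam + - (sg * (2 * eta))) <= (1 + C1 * D ^+ 2)%:E)%E.
    have hD : `|lam - sg * (2 * eta)| <= D by apply: Dlam; rewrite sgt//; lra.
    apply: le_trans (up _ hD) _; rewrite lee_fin lerD2l ler_wpM2l ?(ltW C10)//.
    rewrite -real_normK ?num_real//; apply: lerXn2r => //; rewrite nnegrE//.
    by have := normr_ge0 lam; lra.
  apply: le_trans (lee_wpmul2l _ h) _; first by rewrite lee_fin.
  rewrite -EFinM lee_fin ler_piMl//; last by rewrite invf_le1.
  by rewrite addr_ge0// mulr_ge0 ?sqr_ge0// ltW.
Qed.

End Tilt.
(** * The walk as an evolution of mass functions *)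

Section Link.
Context {d : measure_display} {T : measurableType d} {R : realType}
  {P : probability T R} {n : nat}.
Variable X : 'I_n.+1 -> {RV P >-> int}.
Hypothesis indep : mutually_independent X.
Variable u : R.

Definition mean (i : 'I_n.+1) : R := fine 'E_P[(fun w => (X i w)%:~R : R)].

Definition isum (k : nat) (w : T) : int := \sum_(i < n.+1 | (i < k)%N) X i w.

Definition drift (k : nat) : R := \sum_(i < n.+1 | (i < k)%N) mean i.

Lemma centered_walkE k w :
  centered_walk X u k w = u + ((isum k w)%:~R - drift k).
Proof.
by rewrite /centered_walk /centered /isum /drift sumrB rmorph_sum.
Qed.

Lemma sum_ltS {V : nmodType} (F : 'I_n.+1 -> V) k : (k <= n)%N ->
  \sum_(i < n.+1 | (i < k.+1)%N) F i = \sum_(i < n.+1 | (i < k)%N) F i + F (inord k).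
Proof.
move=> kn; rewrite (bigD1 (inord k))/= ?inordK// addrC; congr (_ + _).
apply: eq_bigl => i; rewrite ltnS leq_eqVlt -val_eqE/= inordK//.
by case: ltngtP => //=; rewrite ?andbF.
Qed.

(** The walk is observed through its integer part [isum]; the real position
differs from it by a deterministic quantity at each time. *)
Definition path_event (k : nat) (j : int) : set T :=
  [set w | isum k w = j /\
    forall l, (0 < l <= k)%N -> 0 <= u + ((isum l w)%:~R - drift l)].

Lemma path_event_prefix k j w w' :
  (forall i : 'I_n.+1, (i < k)%N -> X i w = X i w') ->
  path_event k j w -> path_event k j w'.
Proof.
move=> e; have eS l : (l <= k)%N -> isum l w = isum l w'.
  by move=> lk; apply: eq_bigr => i il; apply: e; exact: leq_trans lk.
move=> [Sj al]; split; first by rewrite -eS.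
by move=> l /andP[l0 lk]; rewrite -eS//; apply: al; rewrite l0.
Qed.

Lemma measurable_path_event k j : measurable (path_event k j).
Proof.
exact: (prefix_measurable X k _ (path_event_prefix k j)).
Qed.

Lemma path_event_indep k j l : (k <= n)%N ->
  P (path_event k j `&` [set w | X (inord k) w = l]) =
  (P (path_event k j) * P [set w | X (inord k) w = l])%E.
Proof.
move=> kn; apply: (prefix_independent X indep k _ (path_event_prefix k j)).
by rewrite inordK.
Qed.

Let step_mass k := mass (distribution P (X (inord k))).

Lemma path_eventS k j : (k <= n)%N -> path_event k.+1 j `<=`
  \bigcup_i (path_event k i `&` [set w | X (inord k) w = j - i]).
Proof.
move=> kn w [Sj al]; exists (isum k w) => //; split; last first.
  by rewrite /= -Sj /isum sum_ltS// addrC addKr.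
split=> // l /andP[l0 lk]; apply: al; rewrite l0/=; exact: leqW.
Qed.

Lemma path_event_step k j : (k <= n)%N ->
  (P (path_event k.+1 j) <= \esum_(i in [set: int])
     (fine (P (path_event k i)) * step_mass k (j - i))%:E)%E.
Proof.
move=> kn; apply: le_trans (le_measure_esum P _ _ _ _ _ (path_eventS k j kn)) _.
- exact: measurable_path_event.
- by move=> i; apply: measurableI; [exact: measurable_path_event|exact: measurable_atom].
apply: le_esum => i _.
rewrite -[leLHS]/(P (path_event k i `&` [set w | X (inord k) w = j - i])).
rewrite path_event_indep// EFinM massE fineK//.
by rewrite fin_num_measure//; exact: measurable_path_event.
Qed.

(** The law of the walk killed below 0, tilted by [lam] and normalized by [a] at
each step. *)
Definition path_mass (lam a : R) (k : nat) (j : int) : R :=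
  fine (P (path_event k j)) * expR (lam * (j%:~R - drift k)) / a ^+ k.

Lemma path_mass_ge0 lam a k j : 0 < a -> 0 <= path_mass lam a k j.
Proof.
move=> a0; rewrite divr_ge0 ?exprn_ge0 ?(ltW a0)// mulr_ge0 ?expR_ge0//.
by rewrite fine_ge0// measure_ge0.
Qed.

Lemma path_mass_evolution (lam a : R) : 0 < a ->
  evolution n.+1 (path_mass lam a)
    (fun k => tilt lam a (mean (inord k)) (step_mass k)).
Proof.
move=> a0; split=> [k j|k j kn]; first exact: path_mass_ge0.
have mass0 l : 0 <= step_mass k l by exact: mass_ge0.
have w0 : 0 <= expR (lam * (j%:~R - drift k.+1)) / a ^+ k.+1.
  by rewrite divr_ge0 ?expR_ge0// exprn_ge0// ltW.
rewrite /path_mass -mulrA mulrC EFinM fineK; last first.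
  by rewrite fin_num_measure//; exact: measurable_path_event.
apply: le_trans (lee_wpmul2l _ (path_event_step k j kn)) _; first by rewrite lee_fin.
rewrite -esumZl//; last first.
  by move=> i; rewrite lee_fin mulr_ge0// fine_ge0// measure_ge0.
apply: le_esum => i _; rewrite -EFinM lee_fin le_eqVlt; apply/orP; left; apply/eqP.
rewrite /tilt /drift sum_ltS// -/(drift k).
have -> : lam * (j%:~R - (drift k + mean (inord k))) =
    lam * (i%:~R - drift k) + lam * ((j - i)%:~R - mean (inord k)).
  by rewrite rmorphB/=; ring.
by rewrite expRD exprSr invfM; ring.
Qed.

Lemma path_mass0 lam a j : path_mass lam a 0 j <= (j == 0)%:R.
Proof.
rewrite /path_mass expr0 divr1 /drift big_pred0// subr0.
have [->|j0] := eqVneq j 0.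
  rewrite mulr0 expR0 mulr1 -lee_fin fineK; last first.
    by rewrite fin_num_measure//; exact: measurable_path_event.
  exact/probability_le1/measurable_path_event.
rewrite (_ : path_event 0 j = set0) ?measure0 ?mul0r//.
apply/seteqP; split=> // w [+ _]; rewrite /isum big_pred0// => /eqP.
by rewrite eq_sym (negPf j0).
Qed.

Lemma path_mass_alive lam a k j : 0 <= u ->
  u - drift k + j%:~R < 0 -> path_mass lam a k j = 0.
Proof.
move=> u0 neg; rewrite /path_mass (_ : path_event k j = set0) ?measure0 ?mul0r//.
apply/seteqP; split=> // w [Sj al].
case: k Sj al neg => [Sj _|k Sj al].
  by rewrite -Sj /isum /drift !big_pred0//= subr0 addr0 ltNge u0.
by have := al k.+1; rewrite /= leqnn Sj => /(_ isT); lra.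
Qed.

End Link.
(** * Constants attached to the class of laws *)

Section ClassConstants.
Context {R : realType}.
Variables (c0 delta0 : R) (a : int -> R).
Hypothesis c0_gt0 : 0 < c0.
Hypothesis delta0_gt0 : 0 < delta0.
Hypothesis a01 : forall i, 0 <= a i <= 1.
Hypothesis a_irr : irreducible_aperiodic_seq a.

(** Everything the rest of the proof uses about a law of the class, with
constants depending only on the class.  The scale [D] is small enough for the
quadratic moment bounds and for the tilt to change the weights of the two atoms
by a bounded factor. *)
Lemma class_constants : exists (d1 d2 : int) (c1 C1 D th : R),
  [/\ d1 != d2, 0 < c1 <= 1, 1 <= C1, 0 < D <= 1 & 0 < th] /\
  forall (d : measure_display) (T : measurableType d) (P : probability T R)
    (X : {RV P >-> int}), law_class delta0 c0 a (distribution P X) ->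
  let p := mass (distribution P X) in
  let mu := fine 'E_P[(fun w => (X w)%:~R : R)] in
  [/\ forall t, `|t| <= D -> (laplace p mu t <= (1 + C1 * t ^+ 2)%:E)%E,
      forall t, `|t| <= D -> ((1 + c1 * t ^+ 2)%:E <= laplace p mu t)%E,
      forall lam A, `|lam| <= D -> 0 < A <= 2 -> th <= tilt lam A mu p d1 &
      forall lam A, `|lam| <= D -> 0 < A <= 2 -> th <= tilt lam A mu p d2].
Proof.
have [p0 [b [p0irr _ b0 aE]]] := a_irr.
have [d1 [d2 [d12 p1 p2]]] := irreducible_two_atoms _ p0irr.
have a1 : 0 < a d1 by rewrite aE mulr_gt0.
have a2 : 0 < a d2 by rewrite aE mulr_gt0.
set th0 := Num.min (a d1) (a d2).
have th00 : 0 < th0 by rewrite lt_min a1.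
have th01 : th0 <= 1 by rewrite ge_min; have /andP[_ ->] := a01 d1.
set mB := 2 * c0 / delta0.
have mB0 : 0 < mB by rewrite divr_gt0// mulr_gt0.
set e1 : R := `|d1%:~R : R|; set e2 : R := `|d2%:~R : R|.
have e10 : 0 <= e1 := normr_ge0 _.
have e20 : 0 <= e2 := normr_ge0 _.
set M := e1 + e2 + mB.
have M0 : 0 < M by rewrite /M; lra.
set D := Num.min 1 (Num.min (delta0 / 2) (2 / M)).
have D0 : 0 < D by rewrite !lt_min ltr01 !divr_gt0.
have [D1 Dd DM] : [/\ D <= 1, D <= delta0 / 2 & D <= 2 / M].
  by split; rewrite /D !ge_min lexx ?orbT.
have Dd0 : D <= delta0 by move: Dd delta0_gt0; lra.
set C1 := 16 / delta0 ^+ 2 * expR (2 * c0) * (2 * c0) + 1.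
exists d1, d2, (th0 / 8), C1, D, (th0 * expR (- 2) / 2).
have C10 : 0 <= 16 / delta0 ^+ 2 * expR (2 * c0) * (2 * c0).
  rewrite mulr_ge0//; last by rewrite mulr_ge0// ltW.
  by rewrite mulr_ge0 ?expR_ge0// divr_ge0 ?sqr_ge0.
split.
  split=> //; rewrite ?D0//.
  - by apply/andP; split; lra.
  - by rewrite /C1; lra.
  - by rewrite !mulr_gt0 ?expR_gt0.
move=> d T P X [Xexp Xa] p mu.
have pc t : `|t| <= delta0 -> (exp_moment (distribution P X) t <= c0%:E)%E.
  move=> td; apply: le_trans Xexp; apply: ereal_sup_ubound.
  by exists t.
have bound (x t : R) : 0 <= x -> x <= e1 + e2 -> `|t| <= D -> `|t| * (x + mB) <= 2.
  move=> x0 xe tD; apply: (@le_trans _ _ (2 / M * M)); last by rewrite divfK ?gt_eqF.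
  apply: ler_pM => //; first by rewrite addr_ge0// ltW.
    exact: le_trans DM.
  by rewrite lerD2r.
have p_th1 : th0 <= p d1 by apply: le_trans (Xa d1); rewrite ge_min lexx.
have p_th2 : th0 <= p d2 by apply: le_trans (Xa d2); rewrite ge_min lexx orbT.
have tilted (lam A : R) (k : int) : th0 <= p k -> `|k%:~R : R| <= e1 + e2 -> `|lam| <= D ->
    0 < A <= 2 -> th0 * expR (- 2) / 2 <= tilt lam A mu p k.
  move=> pk ke lD /andP[A0 A2]; rewrite /tilt.
  apply: ler_pM; rewrite ?invr_ge0//.
  - by rewrite mulr_ge0 ?expR_ge0// ltW.
  - apply: ler_pM => //; rewrite ?expR_ge0 ?(ltW th00)// ler_expR.
    have : `|lam * (k%:~R - mu)| <= 2.
      rewrite normrM; have := bound `|k%:~R : R| lam (normr_ge0 _) ke lD.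
      apply: le_trans.
      rewrite ler_wpM2l//; apply: le_trans (ler_normB _ _) _; rewrite lerD2l.
      exact: (mean_bound X _ _ delta0_gt0 pc).
    by rewrite ler_norml => /andP[].
  - by rewrite lef_pV2 ?posrE.
split.
- move=> t tD; apply: le_trans (laplace_le X _ _ delta0_gt0 pc t (le_trans tD Dd)) _.
  by rewrite lee_fin lerD2l ler_wpM2r ?sqr_ge0// /C1 lerDl.
- move=> t tD; apply: (laplace_ge X _ _ delta0_gt0 pc _ _ _ _ d12) => //.
  + exact: ltW.
  + exact: le_trans tD Dd0.
  + by apply: bound => //; rewrite /e1 lerDl.
  + by apply: bound => //; rewrite /e2 lerDr.
- by move=> lam A lD hA; apply: tilted => //; rewrite lerDl.
- by move=> lam A lD hA; apply: tilted => //; rewrite lerDr.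
Qed.

End ClassConstants.

(** * Scalar estimates *)

Section Rates.
Context {R : realType}.

Lemma third_ge N : (3 <= N)%N -> (N <= 5 * (N %/ 3))%N.
Proof. lia. Qed.

Lemma third_le N : ((N %/ 3).*2 + N %/ 3 <= N)%N.
Proof. lia. Qed.

(** Bernoulli's inequality for [x^-1]. *)
Lemma geometric_half (N m : nat) (x : R) :
  (0 < N)%N -> (N <= 6 * m)%N -> 0 < x -> 6 / N%:R <= x^-1 - 1 -> x ^+ m <= 1 / 2.
Proof.
move=> N0 Nm x0 hx.
have N0R : 0 < N%:R :> R by rewrite ltr0n.
have bern k : 1 + k%:R * (6 / N%:R) <= (x^-1) ^+ k.
  elim: k => [|k IH]; first by rewrite mul0r addr0 expr0.
  have y0 : 0 <= 6 / N%:R :> R by rewrite divr_ge0.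
  have h1 : 0 <= k%:R * (6 / N%:R) :> R by rewrite mulr_ge0.
  have h2 : 1 + 6 / N%:R <= x^-1 by lra.
  have h3 : (0 : R) <= 1 + 6 / N%:R by rewrite addr_ge0.
  have h4 : (0 : R) <= 1 + k%:R * (6 / N%:R) by rewrite addr_ge0.
  rewrite exprSr -natr1; apply: le_trans (ler_pM h4 h3 IH h2).
  set y := 6 / N%:R in y0 h1 *; have := mulr_ge0 h1 y0; lra.
have h : 2 <= (x^-1) ^+ m.
  apply: le_trans (bern m); have : 1 <= m%:R * (6 / N%:R) :> R; last by lra.
  by rewrite mulrA ler_pdivlMr// mul1r -natrM ler_nat mulnC.
rewrite -[x]invrK exprVn div1r lef_pV2// posrE ?exprn_gt0 ?invr_gt0//.
Qed.

(** The trivial bound and the ballot bound in a single product; [L] is the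
diffusive scale and [rho * L] the loss caused by the drift of the tilted walk. *)
Lemma min_rate (G rho L w : R) : 1 <= G -> 0 < L -> 1 <= rho * L ->
  Num.min 1 (G * rho * w) <= G * (rho * L) * (Num.min w L / L).
Proof.
move=> G1 L0 rL; have G0 : 0 <= G by lra.
have [wL|Lw] := leP w L.
  rewrite ge_min; apply/orP; right; rewrite le_eqVlt; apply/orP; left.
  by apply/eqP; field; rewrite gt_eqF.
rewrite divff ?gt_eqF// mulr1 ge_min; apply/orP; left.
by rewrite -[1]mulr1 ler_pM.
Qed.

Lemma spread_const (N m : nat) (th : R) : 0 < th -> (0 < N)%N -> (N <= 5 * m)%N ->
  Num.sqrt ((1 + th * m%:R)^-1) <= Num.sqrt (5 / th) / Num.sqrt N%:R.
Proof.
move=> th0 N1 Nm; have N0 : 0 < N%:R :> R by rewrite ltr0n.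
rewrite -sqrtrV ?ler0n// -sqrtrM; last by rewrite divr_ge0// ltW.
apply: ler_wsqrtr; rewrite -[5 / th]invf_div -invfM lef_pV2 ?posrE; last 2 first.
- by rewrite ltr_pwDl// mulr_ge0// ltW.
- by rewrite mulr_gt0// divr_gt0.
have : th * N%:R <= th * (5 * m%:R).
  by rewrite ler_wpM2l ?(ltW th0)// -natrM ler_nat.
have -> : th / 5 * N%:R = th * N%:R / 5 by ring.
by rewrite ler_pdivrMr//; lra.
Qed.

(** The polynomial loss [b ^+ 2] is paid with half of the Gaussian exponent. *)
Lemma gauss_absorb (C1 X b : R) : 1 <= C1 -> 0 <= X -> 0 <= b ->
  b <= 1 + Num.sqrt X / (2 * C1) ->
  b ^+ 2 * expR (- X / (4 * C1)) <= 4 * expR (- X / (8 * C1)).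
Proof.
move=> C11 X0 b0 bX; have C10 : 0 < C1 by lra.
set y := X / (8 * C1); have y0 : 0 <= y by rewrite divr_ge0// mulr_ge0// ltW.
have -> : - X / (4 * C1) = - y + - y by rewrite /y; field; rewrite gt_eqF.
have -> : - X / (8 * C1) = - y by rewrite /y mulNr.
rewrite expRD mulrA ler_wpM2r ?expR_ge0//.
have hy := expR_ge1Dx y.
suff h : b ^+ 2 <= 4 * (1 + y).
  rewrite expRN ler_pdivrMr ?expR_gt0//; apply: le_trans h _.
  by rewrite ler_wpM2l.
set z := Num.sqrt X / (2 * C1) in bX.
have z0 : 0 <= z by rewrite divr_ge0 ?sqrtr_ge0// mulr_ge0// ltW.
have z2 : z ^+ 2 <= 2 * y.
  rewrite /z expr_div_n sqr_sqrtr// /y ler_pdivrMr ?exprn_gt0 ?mulr_gt0//.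
  have -> : 2 * (X / (8 * C1)) * (2 * C1) ^+ 2 = X * C1 by field; rewrite gt_eqF.
  by rewrite ler_peMr.
have h : b ^+ 2 <= (1 + z) ^+ 2 by rewrite ler_pXn2r ?nnegrE ?addr_ge0.
by have := sqr_ge0 (1 - z); lra.
Qed.

(** Both the tilting parameter and [1 / sqrt N] are at most [N ^ (-1/3)] when
the displacement is at most [N ^ alpha]. *)
Lemma scale_small (alpha rho0 : R) (N : nat) : alpha < 2 / 3 -> 0 < rho0 ->
  (1 <= N)%N -> (2 / rho0) ^+ 3 <= N%:R ->
  N%:R `^ alpha / N%:R + (Num.sqrt N%:R)^-1 <= rho0.
Proof.
move=> alpha23 rho00 N1 hN.
have N1R : 1 <= N%:R :> R by rewrite ler1n.
have N0R : 0 < N%:R :> R by rewrite ltr0n.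
have NN0 : N%:R != 0 :> R by rewrite gt_eqF.
set y := (N%:R : R) `^ (1 / 3).
have y0 : 0 < y by rewrite powR_gt0.
have hy : 2 / rho0 <= y.
  have -> : 2 / rho0 = ((2 / rho0) ^+ 3) `^ (1 / 3).
    rewrite -powR_mulrn; last by rewrite divr_ge0// ltW.
    rewrite -powRrM (_ : 3%:R * (1 / 3) = 1 :> R); last by field.
    by rewrite powRr1// divr_ge0// ltW.
  apply: ge0_ler_powR; rewrite ?nnegrE// exprn_ge0// divr_ge0// ltW//.
have b1 : N%:R `^ alpha / N%:R <= y^-1.
  have {1}-> : N%:R^-1 = N%:R `^ (- 1) :> R by rewrite powRN powRr1// ltW.
  rewrite -powRD; last by rewrite NN0 implybT.
  by rewrite /y -powRN ler_powR//; lra.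
have b2 : (Num.sqrt N%:R)^-1 <= y^-1 :> R.
  rewrite -(powR12_sqrt (ltW N0R)) -powRN /y -powRN ler_powR//; lra.
apply: le_trans (lerD b1 b2) _.
have : y^-1 <= rho0 / 2.
  by rewrite -[rho0 / 2]invf_div lef_pV2 ?posrE// divr_gt0.
by lra.
Qed.

End Rates.
(** * The bound on one path event *)

Section PathBound.
Context {R : realType}.
Variables (d1 d2 : int) (c1 C1 D th : R).
Hypothesis d12 : d1 != d2.
Hypothesis c1_range : 0 < c1 <= 1.
Hypothesis C11 : 1 <= C1.
Hypothesis D_range : 0 < D <= 1.
Hypothesis th0 : 0 < th.

(** [eta], [kap], [C2], [eps] and [B] are chosen in this order so that the
conditions of [three_thirds_bound] hold; [K] is large enough for the decay rate
[r] to halve the barrier parameter over a third of the time interval. *)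
Let eta := D / 4.
Let kap := c1 * eta ^+ 2 / 16.
Let C2 := 1 + C1 * D ^+ 2.
Let eps := kap / C2.
Let B := 1 + (1 / eta + 1) ^+ 2 / (4 * eps).
Let K := Num.sqrt ((C1 + 12) / c1).

Definition ballot_const : R := 2 * ((K + 1) * (B + eps)).
Definition small_scale : R := Num.min (c1 * eta / (4 * C1)) (eta / (K + 1)).

Let G := ballot_const.

Let c10 : 0 < c1. Proof. by case/andP: c1_range. Qed.
Let C10 : 0 < C1. Proof. exact: lt_le_trans C11. Qed.
Let D0 : 0 < D. Proof. by case/andP: D_range. Qed.
Let eta0 : 0 < eta. Proof. by rewrite divr_gt0. Qed.
Let kap0 : 0 < kap. Proof. by rewrite divr_gt0// mulr_gt0// exprn_gt0. Qed.
Let C20 : 0 < C2. Proof. by rewrite addr_gt0// mulr_gt0// exprn_gt0. Qed.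
Let eps0 : 0 < eps. Proof. by rewrite divr_gt0. Qed.
Let B1 : 1 <= B.
Proof. by rewrite lerDl divr_ge0 ?sqr_ge0// mulr_ge0// ltW. Qed.
Let K0 : 0 <= K. Proof. exact: sqrtr_ge0. Qed.
Let K2 : c1 * K ^+ 2 = C1 + 12.
Proof.
rewrite sqr_sqrtr; first by field; rewrite gt_eqF.
by rewrite divr_ge0 ?(ltW c10)// addr_ge0// ltW.
Qed.
Let G1 : 1 <= G.
Proof.
have h1 : 1 <= K + 1 by rewrite lerDr.
have h2 : 1 <= B + eps by have := eps0; have := B1; lra.
have := ler_pM ler01 ler01 h1 h2; rewrite /G /ballot_const; lra.
Qed.

Lemma ballot_const_ge1 : 1 <= ballot_const. Proof. exact: G1. Qed.

Lemma small_scale_gt0 : 0 < small_scale.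
Proof.
have K10 : 0 < K + 1 by rewrite ltr_wpDl.
by rewrite lt_min !divr_gt0 ?mulr_gt0.
Qed.

Context {d : measure_display} {T : measurableType d} {P : probability T R}
  {n : nat}.
Variable X : 'I_n.+1 -> {RV P >-> int}.
Hypothesis indep : mutually_independent X.
Hypothesis upper : forall i t, `|t| <= D ->
  (laplace (mass (distribution P (X i))) (mean X i) t <= (1 + C1 * t ^+ 2)%:E)%E.
Hypothesis lower : forall i t, `|t| <= D ->
  ((1 + c1 * t ^+ 2)%:E <= laplace (mass (distribution P (X i))) (mean X i) t)%E.
Hypothesis atom1 : forall i lam A, `|lam| <= D -> 0 < A <= 2 ->
  th <= tilt lam A (mean X i) (mass (distribution P (X i))) d1.
Hypothesis atom2 : forall i lam A, `|lam| <= D -> 0 < A <= 2 ->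
  th <= tilt lam A (mean X i) (mass (distribution P (X i))) d2.

Let N := n.+1.
Let L : R := Num.sqrt N%:R.

Variables (u v : R) (j : int).
Hypothesis u0 : 0 <= u.
Hypothesis v0 : 0 <= v.
Hypothesis endpoint : u + (j%:~R - drift X N) = v.
Hypothesis N3 : (3 <= N)%N.

(** The exponent [C1 * lam ^+ 2 * N - lam * (v - u)] is smallest at this [lam]. *)
Let lam := (v - u) / (2 * C1 * N%:R).
Let rho := `|lam| + L^-1.
Hypothesis rho_small : rho <= small_scale.

Let a := 1 + C1 * lam ^+ 2.
Let s := `|lam| + K * rho.
Let r := a / (1 + c1 * K ^+ 2 * rho ^+ 2).

Let NR0 : 0 < N%:R :> R. Proof. by rewrite ltr0n. Qed.
Let L0 : 0 < L. Proof. by rewrite sqrtr_gt0. Qed.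
Let L2 : L ^+ 2 = N%:R. Proof. by rewrite sqr_sqrtr ?ltW. Qed.
Let rho0 : 0 < rho. Proof. by rewrite ltr_wpDl// invr_gt0. Qed.
Let lam_rho : `|lam| <= rho. Proof. by rewrite lerDl invr_ge0 ltW. Qed.
Let rho1 : rho <= c1 * eta / (4 * C1).
Proof. by apply: le_trans rho_small _; rewrite ge_min lexx. Qed.
Let rho2 : (K + 1) * rho <= eta.
Proof.
have K10 : 0 < K + 1 by rewrite ltr_wpDl.
rewrite mulrC -ler_pdivlMr//; apply: le_trans rho_small _.
by rewrite ge_min lexx orbT.
Qed.
Let s_le : s <= (K + 1) * rho. Proof. by rewrite /s mulrDl mul1r addrC lerD2l. Qed.
Let s0 : 0 < s.
Proof.
have K00 : 0 < K by rewrite sqrtr_gt0 divr_gt0// addr_gt0.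
by rewrite ltr_wpDl// mulr_gt0.
Qed.
Let lam_small : C1 * lam ^+ 2 <= c1 * eta ^+ 2 / 16.
Proof.
have h := le_trans lam_rho rho1.
have z0 := normr_ge0 lam.
have -> : lam ^+ 2 = `|lam| ^+ 2 by rewrite real_normK ?num_real.
have h2 : `|lam| ^+ 2 <= (c1 * eta / (4 * C1)) ^+ 2.
  by apply: lerXn2r => //; rewrite nnegrE// divr_ge0 ?mulr_ge0// ltW.
apply: le_trans (ler_wpM2l (ltW C10) h2) _.
have -> : C1 * (c1 * eta / (4 * C1)) ^+ 2 = c1 * eta ^+ 2 / 16 * (c1 / C1).
  by field; rewrite gt_eqF.
rewrite ler_piMr//; first by rewrite ltW.
rewrite ler_pdivrMr// mul1r; case/andP: c1_range => _ h1; exact: le_trans C11.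
Qed.
Let eta1 : c1 * eta ^+ 2 <= 1.
Proof.
case/andP: c1_range => _ h1; case/andP: D_range => _ h2.
have h3 : eta <= 1 by rewrite /eta; lra.
rewrite -[1]mulr1; apply: ler_pM => //; first by rewrite ltW.
by rewrite exprn_ge0// ltW.
by rewrite exprn_ile1// ltW.
Qed.
Let lam_eta : `|lam| <= eta / 2.
Proof.
apply: le_trans lam_rho _; apply: le_trans rho1 _.
rewrite ler_pdivrMr ?mulr_gt0//.
have h1 : c1 * eta <= C1 * eta.
  by rewrite ler_wpM2r ?(ltW eta0)//; case/andP: c1_range => _ h; exact: le_trans C11.
have h2 : 0 <= C1 * eta by rewrite mulr_ge0 ?(ltW eta0) ?(ltW C10).
by apply: le_trans h1 _; rewrite -subr_ge0; have -> : eta / 2 * (4 * C1) - C1 * eta = C1 * eta by field.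
Qed.
Let a_range : 1 <= a <= 2.
Proof.
have := eta1; have := lam_small; rewrite /a => h1 h2.
have : 0 <= C1 * lam ^+ 2 by rewrite mulr_ge0 ?sqr_ge0// ltW.
by move=> h3; apply/andP; split; lra.
Qed.
Let a0 : 0 < a. Proof. by case/andP: a_range => h _; exact: lt_le_trans h. Qed.
Let lamD : `|lam| <= D. Proof. by apply: le_trans lam_eta _; rewrite /eta; have := D0; lra. Qed.

Let den0 : 0 < 1 + c1 * K ^+ 2 * rho ^+ 2.
Proof. by rewrite ltr_pwDl// mulr_ge0 ?sqr_ge0// mulr_ge0 ?sqr_ge0// ltW. Qed.

Let gs k sg : `|sg| = 1 ->
  good_step (tilt lam a (mean X (inord k)) (mass (distribution P (X (inord k)))))
    (mean X (inord k)) sg s eta r kap C2.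
Proof.
move=> sg1; apply: (tilted_good_step _ _ _ c1 C1 D eta K rho s sg) => //.
- by move=> l; exact: mass_ge0.
- exact: upper.
- exact: lower.
- by rewrite c10/=; case/andP: c1_range => _ h; exact: le_trans C11.
- by rewrite /eta mulrC divfK.
- exact: ltW.
- exact: le_trans rho2.
Qed.

Let r_rate : 6 / N%:R <= r^-1 - 1.
Proof.
have rr : lam ^+ 2 + N%:R^-1 <= rho ^+ 2.
  rewrite /rho sqrrD -L2 -exprVn real_normK ?num_real//.
  rewrite -addrA lerD2l lerDr mulrn_wge0// mulr_ge0// invr_ge0 ltW//.
have /andP[_ a2] := a_range.
rewrite /r invf_div lerBrDl ler_pdivlMr//.
have h : (C1 + 12) * (lam ^+ 2 + N%:R^-1) <= c1 * K ^+ 2 * rho ^+ 2.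
  by rewrite K2 ler_wpM2l// addr_ge0// ltW.
have N0 : 0 < N%:R^-1 :> R by rewrite invr_gt0.
have h2 : 6 / N%:R * a <= 12 / N%:R.
  rewrite mulrAC ler_wpM2r ?(ltW N0)//; lra.
have : 0 <= lam ^+ 2 := sqr_ge0 _.
have : 0 <= C1 / N%:R by rewrite divr_ge0 ?ltW.
by rewrite mulrDl mul1r {1}/a; lra.
Qed.

Let r_range : 0 < r <= 1.
Proof.
have r0 : 0 < r by rewrite divr_gt0.
rewrite r0 -[r]invrK invf_le1 ?invr_gt0//.
have : 0 < 6 / N%:R :> R by rewrite divr_gt0.
by have := r_rate; lra.
Qed.

(** The three factors of [three_thirds_bound] give the rate with the loss
[(rho * L) ^+ 2]; undoing the tilt gives the Gaussian factor. *)
Lemma path_event_bound :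
  fine (P (path_event X u N j)) <=
  4 * ballot_const ^+ 2 * Num.sqrt (5 / th) *
  Num.min (u + 1) L * Num.min (v + 1) L / L ^+ 3 *
  expR (- ((v - u) ^+ 2 / N%:R) / (8 * C1)).
Proof.
pose m := (N %/ 3)%N.
have m5 : (N <= 5 * m)%N by exact: third_ge.
have m6 : (N <= 6 * m)%N by apply: leq_trans m5 _; rewrite leq_mul2r orbT.
have m3 : (m.*2 + m <= N)%N by exact: third_le.
have s_eta : 0 < s <= eta by rewrite s0; exact: le_trans s_le rho2.
have disc : (1 / eta + 1) ^+ 2 <= 4 * B * eps.
  have -> : 4 * B * eps = 4 * eps + (1 / eta + 1) ^+ 2.
    by rewrite /B; field; rewrite !gt_eqF.
  by rewrite lerDr mulr_ge0// ltW.
have epsC : eps * C2 <= kap by rewrite divfK// gt_eqF.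
have posN : u - drift X N + j%:~R = v by rewrite -endpoint; ring.
have := three_thirds_bound N m (path_mass X u lam a)
  (fun k => tilt lam a (mean X (inord k)) (mass (distribution P (X (inord k)))))
  (fun k => mean X (inord k)) (fun k => u - drift X k) s eta r kap C2 B eps th d1 d2
  m3 (path_mass_evolution X indep u lam a a0) (path_mass0 X u lam a) _ _ _ _ _ d12
  (ltW th0) _ _ s_eta r_range _ B1 eps0 disc epsC j.
rewrite posN => /(_ _ _ _ _ _ _ _ _ v0).
have drift0 : drift X 0 = 0 by rewrite /drift big_pred0.
rewrite drift0 subr0.
move=> H.
have {H} fN : path_mass X u lam a N j <=
    Num.min 1 (2 * (s * (B + eps)) * (u + 1)) * Num.sqrt ((1 + th * m%:R)^-1) *
    Num.min 1 (2 * (s * (B + eps)) * (v + 1)).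
  apply: H => //.
  - by move=> k kN; rewrite /drift sum_ltS//; ring.
  - by move=> k i _; exact: path_mass_alive.
  - by move=> k _; apply: gs; rewrite normr1.
  - by move=> k _; apply: gs; rewrite normrN1.
  - by move=> k _; apply: atom1 => //; case/andP: a_range => _ ->; rewrite a0.
  - by move=> k _; apply: atom2 => //; case/andP: a_range => _ ->; rewrite a0.
  - apply: (geometric_half N) => //; by case/andP: r_range.
have Be0 : 0 <= B + eps by rewrite addr_ge0 ?(ltW eps0)// (le_trans ler01).
have rL : rho * L = 1 + `|lam| * L by rewrite mulrDl mulVf ?gt_eqF// addrC.
have rL1 : 1 <= rho * L by rewrite rL lerDl mulr_ge0// ltW.
have side w : 0 <= w -> Num.min 1 (2 * (s * (B + eps)) * (w + 1)) <=
    G * (rho * L) * (Num.min (w + 1) L / L).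
  move=> w0; apply: le_trans (min_rate G rho L (w + 1) G1 L0 rL1).
  rewrite le_min ge_min lexx/= ge_min; apply/orP; right.
  rewrite ler_wpM2r ?addr_ge0// /G /ballot_const.
  have -> : 2 * ((K + 1) * (B + eps)) * rho = 2 * ((K + 1) * rho * (B + eps)) by ring.
  by rewrite ler_wpM2l// ler_wpM2r.
have side0 w : 0 <= w -> 0 <= Num.min 1 (2 * (s * (B + eps)) * (w + 1)).
  move=> w0; rewrite le_min ler01/=; apply: mulr_ge0; last exact: addr_ge0.
  by apply: mulr_ge0 => //; apply: mulr_ge0 => //; exact: ltW.
have sq0 := sqrtr_ge0 ((1 + th * m%:R)^-1).
have fN2 : path_mass X u lam a N j <=
   G * (rho * L) * (Num.min (u + 1) L / L) * (Num.sqrt (5 / th) / L) *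
   (G * (rho * L) * (Num.min (v + 1) L / L)).
  apply: le_trans fN _; apply: ler_pM; rewrite ?side0 ?side//.
    by rewrite mulr_ge0 ?side0.
  apply: ler_pM; rewrite ?side0 ?side//.
  exact: spread_const.
pose Y := (v - u) ^+ 2 / N%:R.
have Y0 : 0 <= Y by rewrite divr_ge0 ?sqr_ge0// ltW.
have Pf : fine (P (path_event X u N j)) =
    path_mass X u lam a N j * (a ^+ N * expR (- (lam * (v - u)))).
  rewrite /path_mass (_ : j%:~R - drift X N = v - u); last by rewrite -endpoint; ring.
  by rewrite expRN; field; rewrite !gt_eqF ?exprn_gt0 ?expR_gt0.
have tail : a ^+ N * expR (- (lam * (v - u))) <= expR (- Y / (4 * C1)).
  have h : a ^+ N <= expR (C1 * lam ^+ 2) ^+ N.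
    by apply: lerXn2r; rewrite ?nnegrE ?expR_ge0 ?(ltW a0)// expR_ge1Dx.
  apply: le_trans (ler_wpM2r (expR_ge0 _) h) _.
  rewrite -expRM_natl -expRD ler_expR le_eqVlt; apply/orP; left; apply/eqP.
  by rewrite /Y /lam; field; rewrite !gt_eqF.
have bY : rho * L <= 1 + Num.sqrt Y / (2 * C1).
  rewrite rL lerD2l /Y sqrtrM ?sqr_ge0// sqrtr_sqr sqrtrV ?ler0n// -/L /lam normrM.
  rewrite [`|_^-1|]gtr0_norm; last by rewrite invr_gt0 !mulr_gt0.
  by rewrite -L2 le_eqVlt; apply/orP; left; apply/eqP; field; rewrite !gt_eqF.
have absorb := gauss_absorb C1 Y (rho * L) C11 Y0 (le_trans ler01 rL1) bY.
have pm0 := path_mass_ge0 X u lam a N j a0.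
rewrite Pf; apply: le_trans (ler_pM pm0 _ fN2 tail) _.
  by rewrite mulr_ge0 ?expR_ge0// exprn_ge0// ltW.
set M := G ^+ 2 * Num.sqrt (5 / th) * Num.min (u + 1) L * Num.min (v + 1) L / L ^+ 3.
have M0 : 0 <= M.
  rewrite divr_ge0 ?exprn_ge0 ?(ltW L0)//.
  rewrite !mulr_ge0 ?sqrtr_ge0// ?le_min ?(ltW L0) ?addr_ge0//; exact: le_trans ler01 G1.
have -> : G * (rho * L) * (Num.min (u + 1) L / L) * (Num.sqrt (5 / th) / L) *
   (G * (rho * L) * (Num.min (v + 1) L / L)) * expR (- Y / (4 * C1)) =
   M * ((rho * L) ^+ 2 * expR (- Y / (4 * C1))).
  by rewrite /M; field; rewrite gt_eqF.
apply: le_trans (ler_wpM2l M0 absorb) _.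
rewrite le_eqVlt; apply/orP; left; apply/eqP.
by rewrite /M -/G /Y; ring.
Qed.

End PathBound.
(** * The bound for centered walks *)

Theorem lemma6p2 (R : realType) (c0 delta0 : R) (a : int -> R) (alpha : R)
    (c0_gt0 : 0 < c0) (delta0_gt0 : 0 < delta0)
    (a01 : forall i, 0 <= a i <= 1) (a_irr : irreducible_aperiodic_seq a)
    (alpha_range : 1 / 2 < alpha < 2 / 3) :
  exists (c C : R) (n0 : nat),
    [/\ 0 < c, 0 < C, (1 <= n0)%N &
      forall n : nat, (n0 <= n)%N ->
      forall (d : measure_display) (T : measurableType d)
        (P : probability T R) (X : 'I_n -> {RV P >-> int}),
        mutually_independent X ->
        (forall i, law_class delta0 c0 a (distribution P (X i))) ->
      forall u v : R,
        0 <= u <= n%:R `^ alpha -> 0 <= v <= n%:R `^ alpha ->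
        (P [set w | centered_walk X u n w = v /\
                    (0 <= centered_walk_min X u w)%R] <=
         (C * Num.min (u + 1) (Num.sqrt n%:R) * Num.min (v + 1) (Num.sqrt n%:R)
            / (n%:R `^ (3 / 2)) * expR (- c * (u - v) ^+ 2 / n%:R))%:E)%E].
Proof.
have [d1 [d2 [c1 [C1 [D [th [[d12 c1_range C11 D_range th0] Hclass]]]]]]] :=
  class_constants c0 delta0 a c0_gt0 delta0_gt0 a01 a_irr.
have C10 : 0 < C1 := lt_le_trans ltr01 C11.
pose G := ballot_const c1 C1 D.
pose rho0 := small_scale c1 C1 D.
have G1 : 1 <= G by exact: ballot_const_ge1.
have rho00 : 0 < rho0 by exact: small_scale_gt0.
exists (8 * C1)^-1, (4 * G ^+ 2 * Num.sqrt (5 / th)),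
  (Num.bound ((2 / rho0) ^+ 3) + 3)%N.
split.
- by rewrite invr_gt0 mulr_gt0.
- apply: mulr_gt0; last by rewrite sqrtr_gt0 divr_gt0.
  by rewrite mulr_gt0// exprn_gt0// (lt_le_trans ltr01).
- by rewrite addnS.
move=> [|n]; first by rewrite addnS.
move=> n0n d T P X indep cls u v /andP[u0 un] /andP[v0 vn].
set E := [set w | _].
have N3 : (3 <= n.+1)%N by apply: leq_trans n0n; rewrite leq_addl.
have NR0 : 0 < n.+1%:R :> R by rewrite ltr0n.
set L := Num.sqrt n.+1%:R.
have L0 : 0 < L by rewrite sqrtr_gt0.
have powE : n.+1%:R `^ (3 / 2) = L ^+ 3 :> R.
  rewrite mulrC powRrM (powR12_sqrt (ltW NR0)) -/L.
  by rewrite -[3]/(3%:R) powR_mulrn// ltW.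
rewrite powE.
set RHS := (X in (_ <= X%:E)%E).
have EP j w : E w -> isum X n.+1 w = j -> path_event X u n.+1 j w.
  move=> [_ wmin] Sj; split=> // l /andP[l0 lN].
  rewrite -centered_walkE; apply: le_trans wmin _.
  by apply: (ge_bigmin_seq _ l); rewrite // mem_index_iota l0.
have [[w0 Ew0]|E0] := pselect (exists w, E w); last first.
  rewrite (_ : E = set0); last first.
    by apply/seteqP; split=> // w Ew; case: E0; exists w.
  rewrite measure0 lee_fin /RHS mulr_ge0 ?expR_ge0// divr_ge0 ?exprn_ge0 ?(ltW L0)//.
  have min0 w : 0 <= w -> 0 <= Num.min (w + 1) L.
    by move=> w0; rewrite le_min (ltW L0) addr_ge0.
  by do 2 (apply: mulr_ge0; last exact: min0); rewrite mulr_ge0 ?sqrtr_ge0// mulr_ge0 ?sqr_ge0.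
pose j := isum X n.+1 w0.
have endE w : E w -> u + ((isum X n.+1 w)%:~R - drift X n.+1) = v.
  by move=> [+ _]; rewrite centered_walkE.
(* All outcomes in [E] have the same integer sum, since [v] determines it. *)
have Ej : E `<=` path_event X u n.+1 j.
  move=> w Ew; apply: EP => //; apply/eqP; rewrite -(eqr_int R); apply/eqP.
  by have := endE _ Ew; have := endE _ Ew0; rewrite -/j; lra.
have mE : measurable E.
  apply: (prefix_measurable X n.+1) => w w' e.
  rewrite /E /= /centered_walk_min.
  have eW k : centered_walk X u k w = centered_walk X u k w'.
    rewrite /centered_walk; congr (_ + _); apply: eq_bigr => i _.
    by rewrite /centered e.
  rewrite eW => -[-> h]; split=> //; apply: le_trans h _.
  by under eq_bigr do rewrite eW.
apply: (@le_trans _ _ (P (path_event X u n.+1 j))).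
  by apply: le_measure => //; rewrite inE//; exact: measurable_path_event.
rewrite -[leLHS]fineK; last first.
  by rewrite fin_num_measure//; exact: measurable_path_event.
rewrite lee_fin.
have scale : `|(v - u) / (2 * C1 * n.+1%:R)| + L^-1 <= rho0.
  have hN : (2 / rho0) ^+ 3 <= n.+1%:R :> R.
    apply: le_trans (ltW (archi_boundP _)) _.
      by rewrite exprn_ge0// divr_ge0// ltW.
    by rewrite ler_nat; apply: leq_trans n0n; rewrite leq_addr.
  have alpha23 : alpha < 2 / 3 by case/andP: alpha_range.
  apply: le_trans (scale_small alpha rho0 n.+1 alpha23 rho00 _ hN) => //.
  rewrite -/L lerD2r normrM [`|_^-1|]gtr0_norm; last by rewrite invr_gt0 !mulr_gt0.
  have vu : `|v - u| <= n.+1%:R `^ alpha by rewrite ler_norml; apply/andP; split; lra.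
  apply: ler_pM => //; first by rewrite invr_ge0 !mulr_ge0// ltW.
  by rewrite lef_pV2 ?posrE ?mulr_gt0// ler_peMl ?(ltW NR0)//; lra.
apply: le_trans (path_event_bound d1 d2 c1 C1 D th d12 c1_range C11 D_range th0 X
  indep _ _ _ _ u v j u0 v0 (endE _ Ew0) N3 scale) _.
- by move=> i t; case: (Hclass _ _ _ (X i) (cls i)) => + _ _ _; apply.
- by move=> i t; case: (Hclass _ _ _ (X i) (cls i)) => _ + _ _; apply.
- by move=> i lam A; case: (Hclass _ _ _ (X i) (cls i)) => _ _ + _; apply.
- by move=> i lam A; case: (Hclass _ _ _ (X i) (cls i)) => _ _ _; apply.
rewrite /RHS le_eqVlt; apply/orP; left; apply/eqP; congr (_ * expR _).
by field; rewrite !gt_eqF.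
Qed.
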